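(* Let $\alpha,\beta>-1$, $\alpha\ne0$, $\beta\neq0$, and let $n\ge1$ be an integer. Then $\sigma_n(\lambda,\alpha,\beta)$ has a convergent power series $$\sigma_n(\lambda,\alpha,\beta)=-n(n+\beta)+n\lambda-\sum_{m=1}^{\infty}b_m(n,\alpha,\beta)(-\lambda)^m,$$ where the first few coefficients $b_m=b_m(n,\alpha,\beta)$, $m=1,2,\dots,5$, are as follows. Write $A=2n+\alpha+\beta$ and $g=n(\alpha+n)(\beta+n)(\alpha+\beta+n)$. Then $$b_1=-\frac{n(\alpha+n)}{A},\qquad b_2=\frac{g}{(A-1)A^2(A+1)},$$ $$b_3=\frac{(\alpha-\beta)(\alpha+\beta)\,g}{(A-2)(A-1)A^3(A+1)(A+2)},$$ $$b_4=\frac{g\,F}{A^4(A-3)(A-2)(A-1)^2(A+1)^2(A+2)(A+3)},$$ $$b_5=\frac{(\alpha-\beta)(\alpha+\beta)\,g\,E}{A^5(A-4)(A-3)(A-2)(A-1)^2(A+1)^2(A+2)(A+3)(A+4)},$$ with $$\begin{aligned}F={}&(\alpha+\beta-1)(\alpha+\beta)^2(\alpha+\beta+1)(\alpha^2-3\alpha\beta+\beta^2+1)-n^4(8\alpha^2+8\beta^2-4)\\&-8n^3(\alpha+\beta)(2\alpha^2+2\beta^2-1)-2n^2\big[3\alpha^4+12\alpha^3\beta+\alpha^2(18\beta^2-7)+6\alpha\beta(2\beta^2-1)+3\beta^4-7\beta^2+2\big]\\&+2n(\alpha+\beta)\big[\alpha^4-4\alpha^3\beta+\alpha^2(5-10\beta^2)+\alpha(2\beta-4\beta^3)+\beta^4+5\beta^2-2\big],\end{aligned}$$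 $$\begin{aligned}E={}&(\alpha+\beta-1)(\alpha+\beta)^2(\alpha+\beta+1)(\alpha^2-5\alpha\beta+\beta^2+5)+16n^6+48n^5(\alpha+\beta)\\&+4n^4(7\alpha^2+30\alpha\beta+7\beta^2-6)-8n^3\big[(3\alpha-\beta)(\alpha-3\beta)+6\big](\alpha+\beta)\\&-2n^2\big[(14\alpha^2-11)\beta^2+18\alpha(\alpha^2+2)\beta+11\alpha^2(\alpha^2-1)+18\alpha\beta^3+11\beta^4+10\big]\\&-2n(\alpha+\beta)\big[\alpha^4+10\alpha^3\beta+\alpha^2(18\beta^2-23)+2\alpha\beta(5\beta^2+6)+\beta^4-23\beta^2+10\big].\end{aligned}$$
   Context: For real $\lambda$, $P_n(x,\lambda)=x^n+p(n,\lambda)x^{n-1}+\cdots$ is the monic orthogonal polynomial of degree $n$ with respect to $x^{\alpha}(1-x)^{\beta}e^{-\lambda x}$ on $[0,1]$, $p(n,\lambda)$ is its sub-leading coefficient, and $\sigma_n(\lambda,\alpha,\beta)=\sigma_n(\lambda):=n\lambda+\lambda\,p(n,-\lambda)-n(n+\beta)$. *)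

(* Defs.v *)
From HB Require Import structures.
From mathcomp Require Import all_boot all_order all_algebra.
From mathcomp Require Import all_classical all_reals all_analysis.

Set Implicit Arguments.
Unset Strict Implicit.
Unset Printing Implicit Defensive.

Import Order.TTheory GRing.Theory Num.Theory.
Import numFieldNormedType.Exports.
Local Open Scope classical_set_scope.
Local Open Scope ring_scope.

(* The convention chosen by powR at base 0 only matters at the endpoints of
   [0, 1], which are Lebesgue-null. *)
Definition weight (R : realType) (a b l x : R) : R :=
  x `^ a * (1 - x) `^ b * expR (- (l * x)).

Definition is_monic_op (R : realType) (n : nat) (a b l : R) (P : {poly R}) : Prop :=
  [/\ P \is monic, size P = n.+1 &
    forall Q : {poly R}, (size Q <= n)%N ->
      \int[lebesgue_measure]_(x in `[0, 1]) (P.[x] * Q.[x] * weight a b l x) = 0].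

(* For a, b > -1 exactly one polynomial satisfies is_monic_op, so that the
   default value 0 is never taken. *)
Definition monic_op (R : realType) (n : nat) (a b l : R) : {poly R} :=
  xget 0 [set P | is_monic_op n a b l P].

Definition subleading (R : realType) (n : nat) (a b l : R) : R :=
  (monic_op n a b l)`_n.-1.

Definition sigma (R : realType) (n : nat) (a b l : R) : R :=
  n%:R * l + l * subleading n a b (- l) - n%:R * (n%:R + b).

(* c is the value at (a, b) of the rational function N / D. For some admissible
   parameters D vanishes and N / D is a 0/0 expression with a removable
   singularity (for instance A - 1 = 0 when n = 1 and a + b = -1); there the
   value is the one given by continuous extension in (a, b). *)
Definition rational_value (R : realType) (N D : R -> R -> R) (a b c : R) : Prop :=
  (D a b != 0 -> c = N a b / D a b) /\
  (D a b = 0 ->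
    (fun p : R * R => N p.1 p.2 / D p.1 p.2)
      @ within [set p : R * R | D p.1 p.2 != 0] (nbhs (a, b)) --> c).

Definition Acoef (R : realType) (n : nat) (a b : R) : R := 2 * n%:R + a + b.

Definition gcoef (R : realType) (n : nat) (a b : R) : R :=
  n%:R * (a + n%:R) * (b + n%:R) * (a + b + n%:R).

Definition Fcoef (R : realType) (k : nat) (a b : R) : R :=
  let n : R := k%:R in
  (a + b - 1) * (a + b) ^+ 2 * (a + b + 1) * (a ^+ 2 - 3 * a * b + b ^+ 2 + 1)
  - n ^+ 4 * (8 * a ^+ 2 + 8 * b ^+ 2 - 4)
  - 8 * n ^+ 3 * (a + b) * (2 * a ^+ 2 + 2 * b ^+ 2 - 1)
  - 2 * n ^+ 2 * (3 * a ^+ 4 + 12 * a ^+ 3 * b + a ^+ 2 * (18 * b ^+ 2 - 7)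
                  + 6 * a * b * (2 * b ^+ 2 - 1) + 3 * b ^+ 4 - 7 * b ^+ 2 + 2)
  + 2 * n * (a + b) * (a ^+ 4 - 4 * a ^+ 3 * b + a ^+ 2 * (5 - 10 * b ^+ 2)
                       + a * (2 * b - 4 * b ^+ 3) + b ^+ 4 + 5 * b ^+ 2 - 2).

Definition Ecoef (R : realType) (k : nat) (a b : R) : R :=
  let n : R := k%:R in
  (a + b - 1) * (a + b) ^+ 2 * (a + b + 1) * (a ^+ 2 - 5 * a * b + b ^+ 2 + 5)
  + 16 * n ^+ 6 + 48 * n ^+ 5 * (a + b)
  + 4 * n ^+ 4 * (7 * a ^+ 2 + 30 * a * b + 7 * b ^+ 2 - 6)
  - 8 * n ^+ 3 * ((3 * a - b) * (a - 3 * b) + 6) * (a + b)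
  - 2 * n ^+ 2 * ((14 * a ^+ 2 - 11) * b ^+ 2 + 18 * a * (a ^+ 2 + 2) * b
                  + 11 * a ^+ 2 * (a ^+ 2 - 1) + 18 * a * b ^+ 3 + 11 * b ^+ 4 + 10)
  - 2 * n * (a + b) * (a ^+ 4 + 10 * a ^+ 3 * b + a ^+ 2 * (18 * b ^+ 2 - 23)
                       + 2 * a * b * (5 * b ^+ 2 + 6) + b ^+ 4 - 23 * b ^+ 2 + 10).

Definition num2 (R : realType) (n : nat) (a b : R) : R := gcoef n a b.

Definition den2 (R : realType) (n : nat) (a b : R) : R :=
  let A := Acoef n a b in (A - 1) * A ^+ 2 * (A + 1).

Definition num3 (R : realType) (n : nat) (a b : R) : R :=
  (a - b) * (a + b) * gcoef n a b.

Definition den3 (R : realType) (n : nat) (a b : R) : R :=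
  let A := Acoef n a b in (A - 2) * (A - 1) * A ^+ 3 * (A + 1) * (A + 2).

Definition num4 (R : realType) (n : nat) (a b : R) : R :=
  gcoef n a b * Fcoef n a b.

Definition den4 (R : realType) (n : nat) (a b : R) : R :=
  let A := Acoef n a b in
  A ^+ 4 * (A - 3) * (A - 2) * (A - 1) ^+ 2 * (A + 1) ^+ 2 * (A + 2) * (A + 3).

Definition num5 (R : realType) (n : nat) (a b : R) : R :=
  (a - b) * (a + b) * gcoef n a b * Ecoef n a b.

Definition den5 (R : realType) (n : nat) (a b : R) : R :=
  let A := Acoef n a b in
  A ^+ 5 * (A - 4) * (A - 3) * (A - 2) * (A - 1) ^+ 2 * (A + 1) ^+ 2
  * (A + 2) * (A + 3) * (A + 4).

(* Main.v *)
Require Import Defs.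
From HB Require Import structures.
From mathcomp Require Import all_boot all_order all_algebra.
From mathcomp Require Import all_classical all_reals all_analysis.
From mathcomp Require Import measurable_realfun ring lra.

(** For the weight [x^a (1-x)^b exp(- l x)] the coefficients of the recurrence
    [P_(j+1) = (x - alpha_j) P_j - beta_j P_(j-1)] satisfy the Toda equations
    [alpha_j' = beta_j - beta_(j+1)], [beta_j' = beta_j (alpha_(j-1) - alpha_j)]
    in [l]. We go backwards: the Toda equations are solved by formal power series
    whose constant terms are the recurrence coefficients of the monic Jacobi
    polynomials. As these are bounded uniformly in [j], the series converge on a
    common disc. If [U_(n,k)] denotes the value at [x^k P_n] of the functional
    whose moments are those of the weight, expanded in [l], then
    [U_(n,k)' = - U_(n,k+1) + beta_n U_(n-1,k)]; so [U_(n,0)' = - U_(n+1,0) -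
    alpha_n U_(n,0)], and since [U_(n,0)] vanishes at [l = 0] for all [n >= 1], it
    vanishes identically. Hence [P_n] is the orthogonal polynomial for the weight,
    its sub-leading coefficient is [p = - (alpha_0 + ... + alpha_(n-1))], and
    [p' = beta_n]: the coefficients of [p] are polynomials in the Jacobi recurrence
    coefficients, which are continuous in [(a, b)] on [a, b > -1]. *)

Set Implicit Arguments.
Unset Strict Implicit.
Unset Printing Implicit Defensive.

Import Order.TTheory GRing.Theory Num.Theory.
Import numFieldNormedType.Exports.
Local Open Scope classical_set_scope.
Local Open Scope ring_scope.

(** * Formal power series *)

(** A type of its own, so that multiplication can be the Cauchy product instead of the pointwise
    one. *)
Definition fps (R : comNzRingType) : Type := nat -> R.

HB.instance Definition _ (R : comNzRingType) :=
  GRing.Zmodule.copy (fps R) (nat -> R).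

Section FormalPowerSeries.
Variable R : comNzRingType.
Implicit Types f g h : fps R.

Definition fps_one : fps R := fun m => (m == 0%N)%:R.

Definition fps_mul f g : fps R :=
  fun m => \sum_(i < m.+1) f i * g (m - i)%N.

Let trunc N f : {poly R} := \poly_(i < N) f i.

(** A coefficient of a Cauchy product involves no later coefficient of the factors, so truncation
    transfers the ring axioms from [{poly R}]. *)
Let trunc_mul N f g m : (m < N)%N ->
  fps_mul f g m = (trunc N f * trunc N g)`_m.
Proof.
move=> mN; rewrite coefM; apply: eq_bigr => i _.
have iN : (i < N)%N by apply: leq_ltn_trans mN; rewrite -ltnS.
by rewrite !coef_poly iN (leq_ltn_trans (leq_subr i m) mN).
Qed.

Let fps_mulC : commutative fps_mul.
Proof.
by move=> f g; apply/funext => m; rewrite !(@trunc_mul m.+1) // mulrC.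
Qed.

Let fps_mulA : associative fps_mul.
Proof.
move=> f g h; apply/funext => m.
(* Truncation is multiplicative only below the cut, which is all that coefficient [m] sees. *)
have cut f' g' : forall i, (i < m.+1)%N ->
    (trunc m.+1 (fps_mul f' g'))`_i = (trunc m.+1 f' * trunc m.+1 g')`_i.
  by move=> i im; rewrite coef_poly im (trunc_mul _ _ im).
rewrite !(@trunc_mul m.+1) //.
transitivity ((trunc m.+1 f * (trunc m.+1 g * trunc m.+1 h))`_m).
  rewrite !coefM; apply: eq_bigr => i _; congr (_ * _).
  by rewrite cut // ltnS leq_subr.
rewrite mulrA !coefM; apply: eq_bigr => i _; congr (_ * _).
by rewrite cut.
Qed.

Let fps_mul1 : left_id fps_one fps_mul.
Proof.
move=> f; apply/funext => m; rewrite /fps_mul /fps_one big_ord_recl /=.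
by rewrite mul1r subn0 big1 ?addr0 // => i _; rewrite mul0r.
Qed.

Let fps_mulDl : left_distributive fps_mul +%R.
Proof.
move=> f g h; apply/funext => m; rewrite /fps_mul.
transitivity (\sum_(i < m.+1) (f i * h (m - i)%N + g i * h (m - i)%N)).
  by apply: eq_bigr => i _; rewrite -mulrDl.
by rewrite big_split.
Qed.

Let fps_one_neq0 : fps_one != 0.
Proof.
apply/eqP => /(congr1 (fun f => f 0%N)) /eqP; rewrite /fps_one /=.
by apply/negP; exact: oner_neq0.
Qed.

HB.instance Definition _ := GRing.Zmodule_isComNzRing.Build (fps R)
  fps_mulA fps_mulC fps_mul1 fps_mulDl fps_one_neq0.

Lemma fpsDE f g m : (f + g) m = f m + g m. Proof. by []. Qed.
Lemma fpsNE f m : (- f) m = - f m. Proof. by []. Qed.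
Lemma fps0E m : (0 : fps R) m = 0. Proof. by []. Qed.
Lemma fpsME f g m : (f * g) m = \sum_(i < m.+1) f i * g (m - i)%N.
Proof. by []. Qed.

Lemma fpsM0E f g : (f * g) 0%N = f 0%N * g 0%N.
Proof. by rewrite fpsME big_ord1. Qed.

Definition fps_deriv f : fps R := fun m => f m.+1 *+ m.+1.

Lemma fps_derivD f g : fps_deriv (f + g) = fps_deriv f + fps_deriv g.
Proof. by apply/funext => m; rewrite /fps_deriv fpsDE mulrnDl. Qed.

Lemma fps_derivN f : fps_deriv (- f) = - fps_deriv f.
Proof. by apply/funext => m; rewrite /fps_deriv fpsNE mulNrn. Qed.

Lemma fps_derivM f g : fps_deriv (f * g) = fps_deriv f * g + f * fps_deriv g.
Proof.
apply/funext => m; rewrite fpsDE !fpsME /fps_deriv fpsME.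
(* The multiplicity [m + 1] splits as [i + (m + 1 - i)]: the first part differentiates [f], the
   second [g]. *)
have -> : (\sum_(i < m.+2) f i * g (m.+1 - i)%N) *+ m.+1 =
   \sum_(i < m.+2) f i * g (m.+1 - i)%N *+ i +
   \sum_(i < m.+2) f i * g (m.+1 - i)%N *+ (m.+1 - i).
  rewrite -big_split -sumrMnl; apply: eq_bigr => i _ /=.
  by rewrite -mulrnDr subnKC // -ltnS.
congr (_ + _).
  rewrite big_ord_recl /= mulr0n add0r; apply: eq_bigr => i _ /=.
  by rewrite subSS mulrnAl.
rewrite big_ord_recr /= subnn mulr0n addr0; apply: eq_bigr => i _ /=.
by rewrite subSn ?leq_ord // mulrnAr.
Qed.

End FormalPowerSeries.

(** * Toda equations *)

Section MixedMoments.
Variables (S : comNzRingType) (al be mu : nat -> S).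

(* [mixed_moment n k] is the value at [x ^ k * P_n] of the functional with
   moments [mu], where [P_(n+1) = (x - al n) P_n - be n P_(n-1)]. *)
Fixpoint mixed_moment n : nat -> S :=
  if n is n1.+1 then fun k =>
    mixed_moment n1 k.+1 - al n1 * mixed_moment n1 k
    - be n1 * (if n1 is n2.+1 then mixed_moment n2 k else 0)
  else mu.

Hypothesis be0 : be 0%N = 0.

(** Since [be 0 = 0], the value at [0.-1 = 0] is multiplied by zero and the case [n = 0] needs no
    separate treatment. *)
Lemma mixed_momentS n k : mixed_moment n.+1 k =
  mixed_moment n k.+1 - al n * mixed_moment n k - be n * mixed_moment n.-1 k.
Proof. by case: n => [|n] //=; rewrite be0 !mul0r. Qed.

(** Read backwards, the recurrence writes [x ^ (k+1) * P_n] through [x ^ k] times [P_(n+1)], [P_n]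
    and [P_(n-1)]; hence the induction on [k]. *)
Lemma mixed_moment_orthogonal :
  (forall n, mixed_moment n.+1 0 = 0) ->
  forall k n, (k < n)%N -> mixed_moment n k = 0.
Proof.
move=> H0; elim=> [[//|n _]|k IH [//|n] kn]; first exact: H0.
have := mixed_momentS n.+1 k; rewrite (IH n.+2) ?(IH n.+1) ?(IH n) //=.
- by rewrite !mulr0 !subr0.
- exact: ltnW.
- exact/ltnW/ltnW.
Qed.

End MixedMoments.

(** * Formal solution of the Toda equations and the orthogonality it preserves *)

Section Toda.
Variables (R : numFieldType) (al0 be0 : nat -> R).

(* The row [m] of [toda_table N] is the final one as soon as [m <= N]. *)
Fixpoint toda_table (N : nat) : nat -> nat -> R * R :=
  if N is N'.+1 then fun m j =>
    let T := toda_table N' in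
    if (m <= N')%N then T m j else
    (((T N' j).2 - (T N' j.+1).2) / N%:R,
     (\sum_(i < N) (T i j).2 * ((T (N' - i)%N j.-1).1 - (T (N' - i)%N j).1))
     / N%:R)
  else fun _ j => (al0 j, be0 j).

Definition toda_alpha j : fps R := fun m => (toda_table m m j).1.
Definition toda_beta j : fps R := fun m => (toda_table m m j).2.

Let toda_tableE N m j : (m <= N)%N -> toda_table N m j = toda_table m m j.
Proof.
elim: N => [|N IH]; first by rewrite leqn0 => /eqP ->.
by rewrite leq_eqVlt => /predU1P[-> //|mN] /=; rewrite -ltnS mN IH.
Qed.

Lemma toda_alpha0 j : toda_alpha j 0 = al0 j. Proof. by []. Qed.
Lemma toda_beta0 j : toda_beta j 0 = be0 j. Proof. by []. Qed.

Lemma toda_alphaS j m :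
  toda_alpha j m.+1 = (toda_beta j m - toda_beta j.+1 m) / m.+1%:R.
Proof. by rewrite /toda_alpha /= ltnn. Qed.

Lemma toda_betaS j m : toda_beta j m.+1 =
  (toda_beta j * (toda_alpha j.-1 - toda_alpha j)) m / m.+1%:R.
Proof.
rewrite /toda_beta /= ltnn /=; congr (_ / _); apply: eq_bigr => i _.
by rewrite !toda_tableE // ?leq_subr // -ltnS.
Qed.

Lemma toda_alpha_deriv j :
  fps_deriv (toda_alpha j) = toda_beta j - toda_beta j.+1.
Proof.
apply/funext => m; rewrite /fps_deriv toda_alphaS -[LHS]mulr_natr mulfVK //.
Qed.

Lemma toda_beta_deriv j : fps_deriv (toda_beta j) =
  toda_beta j * (toda_alpha j.-1 - toda_alpha j).
Proof.
apply/funext => m; rewrite /fps_deriv toda_betaS -[LHS]mulr_natr mulfVK //.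
Qed.

Lemma toda_beta_eq0 : be0 0%N = 0 -> toda_beta 0 = 0.
Proof.
move=> b0; apply/funext; elim/ltn_ind => -[//|m] IH.
rewrite toda_betaS fpsME big1 ?mul0r // => i _.
by rewrite IH ?mul0r.
Qed.

(** Induction on [m], uniformly in [j]. In the equation for alpha the two terms cost a factor 2; in
    the one for beta each of the [m + 1] products costs [2 * C], and their number cancels against
    the division by [m + 1]. *)
Lemma toda_bound (C rho : R) :
  (forall j, `|al0 j| <= C) -> (forall j, `|be0 j| <= C) ->
  2 <= rho -> C * 2 <= rho -> forall m j,
  `|toda_alpha j m| <= C * rho ^+ m /\ `|toda_beta j m| <= C * rho ^+ m.
Proof.
move=> HA HB rho2 rhoC; have C0 : 0 <= C by exact: le_trans (HA 0%N).
have rho0 : 0 <= rho by apply: le_trans rho2; rewrite ler0n.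
elim/ltn_ind => -[_ j|m IH j]; first by rewrite expr0 mulr1 toda_alpha0 toda_beta0.
have X0 : 0 <= C * rho ^+ m by rewrite mulr_ge0 // exprn_ge0.
have m0 : 0 < m.+1%:R :> R by rewrite ltr0n.
have m1 : 1 <= m.+1%:R :> R by rewrite ler1n.
split.
  rewrite toda_alphaS normrM normfV (gtr0_norm m0) ler_pdivrMr //.
  apply: le_trans (ler_normB _ _) _.
  apply: (@le_trans _ _ (C * rho ^+ m + C * rho ^+ m)).
    by apply: lerD; apply (IH m (ltnSn m)).
  have -> : C * rho ^+ m + C * rho ^+ m = C * rho ^+ m * 2 by ring.
  rewrite exprSr [C * (_ * _)]mulrA.
  apply: (@le_trans _ _ (C * rho ^+ m * rho)); first by rewrite ler_wpM2l.
  by rewrite ler_peMr // mulr_ge0.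
rewrite toda_betaS normrM normfV (gtr0_norm m0) ler_pdivrMr // fpsME.
apply: le_trans (ler_norm_sum _ _ _) _.
apply: (@le_trans _ _ (\sum_(i < m.+1) C * rho ^+ m.+1)); last first.
  by rewrite sumr_const card_ord mulr_natr.
apply: ler_sum => i _; rewrite normrM fpsDE fpsNE.
have im : (i <= m)%N by rewrite -ltnS.
apply: (@le_trans _ _ (C * rho ^+ i * (C * rho ^+ (m - i) + C * rho ^+ (m - i)))).
  apply: ler_pM => //; first by apply (IH i (ltn_ord i)).
  apply: le_trans (ler_normB _ _) _.
  by apply: lerD; apply IH; rewrite ltnS leq_subr.
have -> : rho ^+ m.+1 = rho ^+ i * (rho * rho ^+ (m - i)).
  by rewrite -exprS -exprD addnS subnKC.
have -> : C * rho ^+ i * (C * rho ^+ (m - i) + C * rho ^+ (m - i)) =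
  C * (rho ^+ i * (C * 2 * rho ^+ (m - i))) by ring.
rewrite ler_wpM2l // ler_wpM2l ?exprn_ge0 // ler_wpM2r ?exprn_ge0 //.
Qed.

Variable mu : nat -> fps R.
Hypothesis be00 : be0 0%N = 0.
Hypothesis mu_deriv : forall k, fps_deriv (mu k) = - mu k.+1.

Let U := mixed_moment toda_alpha toda_beta mu.
Let US n k : U n.+1 k =
    U n k.+1 - toda_alpha n * U n k - toda_beta n * U n.-1 k :=
  mixed_momentS toda_alpha mu (toda_beta_eq0 be00) n k.

(** Differentiate the recurrence and insert the Toda equations. The recurrence has depth two, so two
    consecutive indices are carried through the induction. *)
Lemma toda_mixed_moment_deriv n k :
  fps_deriv (U n k) = - U n k.+1 + toda_beta n * U n.-1 k.
Proof.
have U0 : U 0%N = mu by [].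
(* Only the recurrence and [U 0 = mu] are retained, so that the fixpoint is never unfolded. *)
move: (US) U0; clear US; clearbody U => US U0.
suff: (forall k, fps_deriv (U n k) = - U n k.+1 + toda_beta n * U n.-1 k) /\
  (forall k, fps_deriv (U n.+1 k) = - U n.+1 k.+1 + toda_beta n.+1 * U n k).
  by case.
elim: n {k} => [|n [IH1 IH2]].
  have B0 := toda_beta_eq0 be00.
  have D0 k : fps_deriv (U 0%N k) = - U 0%N k.+1 + toda_beta 0 * U 0%N k.
    by rewrite B0 mul0r addr0 U0 mu_deriv.
  split => // k; rewrite !US !fps_derivD !fps_derivN !fps_derivM.
  rewrite !D0 toda_alpha_deriv toda_beta_deriv !B0 ?succnK; ring.
split => // k; rewrite !(US n.+1) !fps_derivD !fps_derivN !fps_derivM.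
rewrite !succnK !IH2 !IH1 !toda_alpha_deriv !toda_beta_deriv !succnK.
(* What remains is [toda_beta n.+1] times the recurrence for [U n.+1 k]. *)
rewrite (US n k).  ring.
Qed.

Lemma toda_orthogonal :
  (forall n, U n.+1 0%N 0%N = 0) -> forall k n, (k < n)%N -> U n k = 0.
Proof.
move=> U0; apply: mixed_moment_orthogonal; first exact: toda_beta_eq0.
have DU n : fps_deriv (U n.+1 0%N) = - U n.+2 0%N - toda_alpha n.+1 * U n.+1 0%N.
  by rewrite toda_mixed_moment_deriv (US n.+1 0%N) succnK; ring.
(* By [DU], coefficient [m + 1] of each [U n.+1 0] is a combination of coefficients of index at most
   [m] of the same family, so the induction is on [m], for all [n] at once. *)
suff H m : forall n, U n.+1 0%N m = 0 by move=> n; apply/funext => m; exact: H.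
elim/ltn_ind: m => -[_ n|m IH n]; first exact: U0.
have := congr1 (fun f => f m) (DU n); rewrite /fps_deriv fpsDE !fpsNE fpsME.
rewrite (IH m) // big1 => [/eqP|i _]; last first.
  by rewrite IH ?mulr0 // ltnS leq_subr.
by rewrite !oppr0 addr0 mulrn_eq0 /= => /eqP.
Qed.

End Toda.

(** * Evaluation of power series *)

Section CauchyProduct.
Variable R : realType.
Implicit Types u v : nat -> R.

Let conv u v : nat -> R := fun m => \sum_(i < m.+1) u i * v (m - i)%N.

Let seriesE u N : series u N = \sum_(i < N) u i.
Proof. by rewrite /series /= big_mkord. Qed.

Let series_homo u : (forall i, 0 <= u i) -> nondecreasing_seq (series u).
Proof. by move=> u0 i j; apply: nondecreasing_series. Qed.

Let series_conv u v N :
  series (conv u v) N = \sum_(i < N) u i * series v (N - i)%N.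
Proof.
elim: N => [|N IH]; first by rewrite big_ord0 /series /= big_geq.
rewrite seriesSr IH /conv !big_ord_recr /= addrA -big_split /=; congr (_ + _).
  apply: eq_bigr => i _.
  by rewrite subSn ?seriesSr ?mulrDr // ltnW.
by rewrite subSnn subnn seriesSr /series /= big_geq // add0r.
Qed.

(** For nonnegative terms this bound and the next one compare index sets: the triangle [i + j < N]
    lies in the square [i, j < N], which lies in the triangle [i + j < 2 N]. *)
Let conv_le u v N : (forall i, 0 <= u i) -> (forall i, 0 <= v i) ->
  series (conv u v) N <= series u N * series v N.
Proof.
move=> u0 v0; rewrite series_conv (seriesE u) mulr_suml.
apply: ler_sum => i _; rewrite ler_wpM2l //.
by apply: series_homo => //; exact: leq_subr.
Qed.

Let conv_ge u v N : (forall i, 0 <= u i) -> (forall i, 0 <= v i) ->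
  series u N * series v N <= series (conv u v) (N + N)%N.
Proof.
move=> u0 v0; rewrite series_conv (seriesE u) mulr_suml.
rewrite big_split_ord /= -[leLHS]addr0 lerD //.
  apply: ler_sum => i _; rewrite ler_wpM2l //; apply: series_homo => //.
  by rewrite -addnBA ?leq_addr // ltnW.
apply: sumr_ge0 => i _; rewrite mulr_ge0 //.
by rewrite seriesE; apply: sumr_ge0.
Qed.

Let conv_cvg u v : (forall i, 0 <= u i) -> (forall i, 0 <= v i) ->
  cvgn (series u) -> cvgn (series v) ->
  series (conv u v) @ \oo --> limn (series u) * limn (series v).
Proof.
move=> u0 v0 cu cv.
have w0 i : 0 <= conv u v i by apply: sumr_ge0 => j _; rewrite mulr_ge0.
have cuv : (fun N => series u N * series v N) @ \oo -->
    limn (series u) * limn (series v) by exact: cvgM.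
have lim0 (f : nat -> R) : (forall i, 0 <= f i) -> forall N, 0 <= series f N.
  by move=> f0 N; rewrite seriesE; apply: sumr_ge0.
have le1 N : series (conv u v) N <= limn (series u) * limn (series v).
  apply: le_trans (conv_le N u0 v0) _.
  apply: ler_pM; rewrite ?lim0 //; apply: nondecreasing_cvgn_le => //.
    exact: series_homo.
  exact: series_homo.
have cw : cvgn (series (conv u v)).
  apply: nondecreasing_is_cvgn; first exact: series_homo.
  by exists (limn (series u) * limn (series v)) => _ [N _ <-].
suff -> : limn (series u) * limn (series v) = limn (series (conv u v)) by [].
apply/le_anti/andP; split; last by apply: limr_le => //; exact: nearW.
rewrite -(cvg_lim _ cuv) //; apply: limr_le; first by apply/cvg_ex; eexists; exact: cuv.
apply: nearW => N; apply: le_trans (conv_ge N u0 v0) _.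
by apply: nondecreasing_cvgn_le => //; exact: series_homo.
Qed.

(** Both differences are sums over the part of the square [i, j < N] outside the triangle, where the
    triangle inequality applies termwise. This reduces the signed case to the nonnegative one. *)
Let cauchy_error u v N :
  `|series u N * series v N - series (conv u v) N| <=
  series (fun i => `|u i|) N * series (fun i => `|v i|) N -
  series (conv (fun i => `|u i|) (fun i => `|v i|)) N.
Proof.
have E f g : series f N * series g N - series (conv f g) N =
    \sum_(i < N) f i * (\sum_(N - i <= j < N) g j).
  rewrite series_conv (seriesE f) mulr_suml -sumrB.
  apply: eq_bigr => i _; rewrite -mulrBr /series /=.
  by rewrite (@big_cat_nat _ _ _ (N - i)%N) ?leq_subr //= addrAC subrr add0r.
rewrite !E; apply: le_trans (ler_norm_sum _ _ _) _.
apply: ler_sum => i _; rewrite normrM ler_wpM2l //; exact: ler_norm_sum.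
Qed.

Lemma cauchy_product_cvg u v :
  cvgn [normed series u] -> cvgn [normed series v] ->
  series (fun m => \sum_(i < m.+1) u i * v (m - i)%N) @ \oo -->
  limn (series u) * limn (series v).
Proof.
move=> cu cv.
have cuv : (fun N => series u N * series v N) @ \oo -->
    limn (series u) * limn (series v) by apply: cvgM; exact: normed_cvg.
have E0 : (fun N => series u N * series v N - series (conv u v) N) @ \oo --> (0 : R).
  apply/norm_cvg0P; apply: (@squeeze_cvgr _ _ _ _ (cst 0)
    (fun N => series (fun i => `|u i|) N * series (fun i => `|v i|) N -
      series (conv (fun i => `|u i|) (fun i => `|v i|)) N)).
  - by apply: nearW => N; rewrite normr_ge0 cauchy_error.
  - exact: cvg_cst.
  - rewrite -[X in _ --> X](subrr (limn [normed series u] * limn [normed series v])).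
    apply: cvgB; first exact: cvgM.
    by apply: conv_cvg.
have -> : series (conv u v) = (fun N => series u N * series v N -
    (series u N * series v N - series (conv u v) N)).
  by apply/funext => N; rewrite opprB addrC subrK.
by rewrite -[X in _ --> X]subr0; exact: cvgB.
Qed.

Lemma cauchy_product_normed u v :
  cvgn [normed series u] -> cvgn [normed series v] ->
  cvgn [normed series (fun m => \sum_(i < m.+1) u i * v (m - i)%N)].
Proof.
move=> cu cv.
apply: (@series_le_cvg _ _ (conv (fun i => `|u i|) (fun i => `|v i|))).
- by move=> n; exact: normr_ge0.
- by move=> n; apply: sumr_ge0 => i _; rewrite mulr_ge0.
- move=> n; apply: le_trans (ler_norm_sum _ _ _) _.
  by apply: ler_sum => i _; rewrite normrM.
- by apply/cvg_ex; eexists; exact: conv_cvg.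
Qed.

End CauchyProduct.

(** * Evaluation at a point respects the ring operations *)

Section Evaluation.
Variables (R : realType) (l : R).
Implicit Types f g : fps R.

Let term f : nat -> R := fun m => f m * l ^+ m.

(** Absolute convergence is required because it is stable under Cauchy products. *)
Definition fps_summable f := cvgn [normed series (fun m => f m * l ^+ m)].

Definition fps_eval f : R := limn (series (fun m => f m * l ^+ m)).

Let termM f g :
  term (f * g) = (fun m => \sum_(i < m.+1) term f i * term g (m - i)%N).
Proof.
apply/funext => m; rewrite /term fpsME mulr_suml; apply: eq_bigr => i _.
have -> : l ^+ m = l ^+ i * l ^+ (m - i) by rewrite -exprD subnKC // -ltnS.
by rewrite mulrACA.
Qed.

Lemma fps_eval_cvg f : fps_summable f ->
  series (fun m => f m * l ^+ m) @ \oo --> fps_eval f.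
Proof. exact: normed_cvg. Qed.

Lemma fps_summableD f g :
  fps_summable f -> fps_summable g -> fps_summable (f + g).
Proof.
move=> cf cg; have := is_cvg_seriesD cf cg.
apply: series_le_cvg => m; first exact: normr_ge0.
  by apply: addr_ge0; exact: normr_ge0.
by rewrite /= fpsDE mulrDl ler_normD.
Qed.

Lemma fps_summableN f : fps_summable f -> fps_summable (- f).
Proof.
move=> cf; rewrite /fps_summable.
suff -> : [normed series (fun m => (- f) m * l ^+ m)] =
          [normed series (fun m => f m * l ^+ m)] by [].
by congr (series _); apply/funext => m /=; rewrite fpsNE mulNr normrN.
Qed.

Lemma fps_summableM f g :
  fps_summable f -> fps_summable g -> fps_summable (f * g).
Proof.
move=> cf cg; have := cauchy_product_normed cf cg.
by rewrite /fps_summable -/(term _) termM.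
Qed.

Lemma fps_summable0 : fps_summable 0.
Proof.
rewrite /fps_summable.
have -> : [normed series (fun m => (0 : fps R) m * l ^+ m)] = cst 0.
  by apply/funext => N; apply: big1 => i _; rewrite /= mul0r normr0.
exact: is_cvg_cst.
Qed.

Lemma fps_eval0 : fps_eval 0 = 0.
Proof.
rewrite /fps_eval.
have -> : series (fun m => (0 : fps R) m * l ^+ m) = cst 0.
  by apply/funext => N; apply: big1 => i _; rewrite mul0r.
exact: lim_cst.
Qed.

Lemma fps_evalD f g : fps_summable f -> fps_summable g ->
  fps_eval (f + g) = fps_eval f + fps_eval g.
Proof.
move=> /normed_cvg cf /normed_cvg cg.
rewrite /fps_eval -lim_seriesD //; congr (limn (series _)).
by apply/funext => m; rewrite fpsDE mulrDl.
Qed.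

Lemma fps_evalN f : fps_summable f -> fps_eval (- f) = - fps_eval f.
Proof.
move=> /normed_cvg cf; rewrite /fps_eval -lim_seriesN //.
by congr (limn (series _)); apply/funext => m; rewrite fpsNE mulNr.
Qed.

Lemma fps_evalM f g : fps_summable f -> fps_summable g ->
  fps_eval (f * g) = fps_eval f * fps_eval g.
Proof.
move=> cf cg; have := cauchy_product_cvg cf cg.
by rewrite -/(term f) -/(term g) -termM => /cvg_lim E; exact: E.
Qed.

Lemma fps_summable_geometric f (C rho : R) :
  (forall m, `|f m| <= C * rho ^+ m) -> rho * `|l| < 1 -> 0 <= rho -> fps_summable f.
Proof.
move=> fC l1 rho0; have C0 : 0 <= C.
  by have := fC 0%N; rewrite expr0 mulr1; exact: le_trans.
have /= : cvgn (series (geometric C (rho * `|l|))).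
  by apply: is_cvg_geometric_series; rewrite ger0_norm ?mulr_ge0.
apply: series_le_cvg => m; first exact: normr_ge0.
  by rewrite /= mulr_ge0 ?exprn_ge0 ?mulr_ge0.
by rewrite /= normrM normrX exprMn mulrA ler_wpM2r ?exprn_ge0.
Qed.

End Evaluation.

(** * Jacobi recurrence coefficients *)

Section Rising.
Variable R : comNzRingType.

(** The Pochhammer symbol. *)
Definition rising (x : R) (k : nat) : R := \prod_(i < k) (x + i%:R).

Lemma rising0 x : rising x 0 = 1. Proof. exact: big_ord0. Qed.

Lemma risingS x k : rising x k.+1 = rising x k * (x + k%:R).
Proof. exact: big_ord_recr. Qed.

(** Subtraction in the ring may replace truncated subtraction, because [k ^_ m] vanishes when
    [k < m]. *)
Lemma natr_ffactSr (k m : nat) :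
  (k ^_ m.+1)%:R = (k ^_ m)%:R * (k%:R - m%:R) :> R.
Proof.
rewrite ffactnSr natrM; have [mk|km] := leqP m k; first by rewrite natrB.
by rewrite ffact_small // !mul0r.
Qed.

End Rising.

Lemma rising_gt0 (R : realFieldType) (x : R) k : 0 < x -> 0 < rising x k.
Proof. by move=> x0; apply: prodr_gt0 => i _; rewrite ltr_wpDr. Qed.

Section Jacobi.
Variables (R : realType) (a b : R).

(* Sub-leading coefficient of the monic Jacobi polynomial of degree [j]; for
   [j = 0] it vanishes even when the denominator [a + b] does. *)
Definition jacobi_sub (j : nat) : R :=
  - (j%:R * (j%:R + a) / (2 * j%:R + a + b)).

Lemma jacobi_sub0 : jacobi_sub 0 = 0.
Proof. by rewrite /jacobi_sub !mul0r oppr0. Qed.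

(** Comparing the coefficients of [x ^ j] in the three-term recurrence gives
    [p_(j+1) = p_j - alpha_j]. *)
Definition jacobi_alpha (j : nat) : R := jacobi_sub j - jacobi_sub j.+1.

(* For [j = 1] the factor [a + b + 1] is cancelled, as it may vanish. *)
Definition jacobi_beta (j : nat) : R :=
  match j with
  | 0 => 0
  | 1 => (1 + a) * (1 + b) / ((a + b + 2) ^+ 2 * (a + b + 3))
  | _ => gcoef j a b / den2 j a b
  end.

(** The quotient of Beta integrals [B(a + k + 1, b + 1) / B(a + 1, b + 1)]. *)
Definition jacobi_moment (k : nat) : R := rising (a + 1) k / rising (a + b + 2) k.

Hypotheses (ha : -1 < a) (hb : -1 < b).

Lemma jacobi_moment_gt0 k : 0 < jacobi_moment k.
Proof. by move: ha hb => ? ?; apply: divr_gt0; apply: rising_gt0; lra. Qed.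

Lemma jacobi_momentS k :
  (a + b + 2 + k%:R) * jacobi_moment k.+1 = (a + 1 + k%:R) * jacobi_moment k.
Proof.
move: ha hb => a1 b1; have k0 : 0 <= k%:R :> R by rewrite ler0n.
have h : rising (a + b + 2) k != 0 by rewrite gt_eqF // rising_gt0 //; lra.
rewrite /jacobi_moment !risingS; field; rewrite h; apply: lt0r_neq0; lra.
Qed.

Lemma jacobi_moment_le1 k : jacobi_moment k <= 1.
Proof.
elim: k => [|k IH]; first by rewrite /jacobi_moment !rising0 divr1.
move: ha hb => a1 b1; have k0 : 0 <= k%:R :> R by rewrite ler0n.
have h : 0 < a + b + 2 + k%:R by lra.
rewrite -(ler_pM2l h) jacobi_momentS mulr1.
have := jacobi_moment_gt0 k; nra.
Qed.

(* Value at [x ^ k P_n] of the normalised Jacobi functional; by Rodrigues'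
   formula it is a quotient of Beta integrals. *)
Let mixed (n k : nat) : R :=
  if n is m.+1 then
    (k ^_ n)%:R * rising (a + 1) k * rising (b + 1) n * rising (a + b + 2) m /
    (rising (a + b + 2) (m + n) * rising (a + b + 2) (k + n))
  else jacobi_moment k.

(** The indices 0 and 1 are treated apart: there [jacobi_beta] has its special values and [mixed 0]
    its separate branch. *)
Let mixedS n k : mixed n.+1 k =
  mixed n k.+1 - jacobi_alpha n * mixed n k - jacobi_beta n * mixed n.-1 k.
Proof.
move: ha hb => a1 b1; have k0 : 0 <= k%:R :> R by rewrite ler0n.
have r0 j : rising (a + b + 2) j != 0 by rewrite gt_eqF // rising_gt0 //; lra.
case: n => [|[|m]].
- have := r0 k.
  rewrite /mixed /jacobi_alpha jacobi_sub0 /jacobi_beta /jacobi_sub /jacobi_moment /=.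
  rewrite ?addn1 ?add0n !risingS ?rising0 ffactn1.
  move=> rk; field. do ?[apply/andP; split] => //; apply: lt0r_neq0; lra.
- have := r0 k.
  rewrite /mixed /jacobi_alpha /jacobi_beta /jacobi_sub /jacobi_moment /=.
  rewrite ?addnS ?addn0 ?addSn ?add0n !risingS ?rising0.
  rewrite !natr_ffactSr !ffactn0.
  move=> rk; field. do ?[apply/andP; split] => //; apply: lt0r_neq0; lra.
- have m0 : 0 <= m%:R :> R by rewrite ler0n.
  have := r0 (m + m)%N; have := r0 (k + m)%N.
  rewrite /mixed /jacobi_alpha /jacobi_beta /jacobi_sub /gcoef /den2 /Acoef /=.
  (* All factorials are brought to the common base symbols at [m + m], [k + m] and [k ^_ m], which
     leaves a rational identity in [m] and [k]. *)
  rewrite !addnS !addSn !risingS ffactSS natrM !natr_ffactSr !natrD.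
  have -> : m.+3%:R = m%:R + 3 :> R by rewrite -addn3 natrD.
  have -> : m.+2%:R = m%:R + 2 :> R by rewrite -addn2 natrD.
  have -> : m.+1%:R = m%:R + 1 :> R by rewrite -addn1 natrD.
  have -> : k.+1%:R = k%:R + 1 :> R by rewrite -addn1 natrD.
  move=> ru rt.
  by field; do ?[apply/andP; split] => //; apply: lt0r_neq0; lra.
Qed.
(** The closed form [mixed] obeys the same recurrence and contains the factor [k ^_ n.+1], which is
    zero at [k = 0]. *)
Lemma jacobi_mixed_moment0 n :
  mixed_moment jacobi_alpha jacobi_beta jacobi_moment n.+1 0 = 0.
Proof.
suff H : forall k,
    mixed_moment jacobi_alpha jacobi_beta jacobi_moment n k = mixed n k /\
    mixed_moment jacobi_alpha jacobi_beta jacobi_moment n.+1 k = mixed n.+1 k.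
  by case: (H 0%N) => _ ->; rewrite /mixed ffact0n !mul0r.
elim: n => [|n IH] k.
  split=> //; rewrite mixed_momentS // (mixedS 0) /=.
split; first by case: (IH k).
rewrite mixed_momentS // (mixedS n.+1); congr (_ - _ * _ - _ * _).
- by case: (IH k.+1).
- by case: (IH k).
- by case: (IH k).
Qed.

Lemma norm_addr_le (t c : R) : 1 <= t -> `|c + t| <= t * (1 + `|c|).
Proof.
move=> t1; apply: le_trans (ler_normD _ _) _.
have := normr_ge0 c; rewrite (ger0_norm (_ : 0 <= t)); nra.
Qed.

(** Both coefficients are rational in [j] with numerator and denominator of the same degree. From
    [j = 2] on they are compared with powers of [t = j]; the finitely many earlier values are added
    to the bound. *)
Lemma jacobi_bounded : exists C : R,
  forall j, `|jacobi_alpha j| <= C /\ `|jacobi_beta j| <= C.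
Proof.
move: ha hb => a1 b1.
pose s := a + b.
pose C1 : R := `|a + 1| * `|s| + 2 * (1 + `|s + 1|).
pose C2 : R := 2 * ((1 + `|a|) * (1 + `|b|) * (1 + `|s|)).
have := normr_ge0 a; have := normr_ge0 b; have := normr_ge0 s.
have := normr_ge0 (s + 1); have := normr_ge0 (a + 1) => a0 s10 s0 nb0 na0.
have C10 : 0 <= C1 by rewrite /C1 addr_ge0 ?mulr_ge0 // addr_ge0.
have C20 : 0 <= C2 by rewrite /C2 !mulr_ge0 // addr_ge0.
exists (`|jacobi_alpha 0| + `|jacobi_alpha 1| + `|jacobi_beta 1| + (C1 + C2)).
have := normr_ge0 (jacobi_alpha 0); have := normr_ge0 (jacobi_alpha 1).
have := normr_ge0 (jacobi_beta 1) => B1 A1 A0.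
case=> [|[|j]]; first by rewrite normr0; split; lra.
  by split; lra.
set t : R := j.+2%:R.
have t2 : 2 <= t by rewrite /t ler_nat.
have t1 : 1 <= t by lra.
have sE : a + b = s by [].
have s2 : -2 < s by rewrite /s; lra.
have tN0 : t ^+ 2 > 0 by rewrite exprn_gt0 //; lra.
have A1t : t <= 2 * t + s by lra.
suff [H1 H2] : `|jacobi_alpha j.+2| <= C1 /\ `|jacobi_beta j.+2| <= C2 by split; lra.
split.
  (* The two sub-leading coefficients grow linearly; on a common denominator their leading parts
     cancel. *)
  have -> : jacobi_alpha j.+2 =
      ((a + 1) * s + 2 * (t * ((s + 1) + t))) / ((2 * t + s) * (2 * t + s + 2)).
    rewrite /jacobi_alpha /jacobi_sub -/t -[j.+3]addn1 natrD -/t /s.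
    by field; do ?[apply/andP; split] => //; apply: lt0r_neq0; lra.
  have d0 : t ^+ 2 <= (2 * t + s) * (2 * t + s + 2).
    by rewrite expr2; apply: ler_pM; lra.
  have d1 : 0 < (2 * t + s) * (2 * t + s + 2) by exact: lt_le_trans d0.
  rewrite normrM normfV (gtr0_norm d1) ler_pdivrMr //.
  apply: (@le_trans _ _ (C1 * t ^+ 2)); last by rewrite ler_wpM2l.
  apply: le_trans (ler_normD _ _) _; rewrite /C1 [leRHS]mulrDl; apply: lerD.
    rewrite normrM ler_peMr ?mulr_ge0 //; nra.
  rewrite !normrM (ger0_norm (_ : 0 <= t)) ?(ger0_norm (_ : 0 <= 2)) ; try lra.
  rewrite -mulrA ler_wpM2l // expr2 mulrCA ler_wpM2l //.
  by have := norm_addr_le (s + 1) t1; rewrite mulrC.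
rewrite /jacobi_beta /gcoef /den2 /Acoef -/t.
have -> : 2 * t + a + b = 2 * t + s by rewrite /s; lra.
rewrite -/s; set d := (X in _ / X).
(* With [A = 2 t + s], [t >= 2] and [s > -2]: [A - 1 >= t / 2], while [A] and [A + 1] are at least
   [t]. The loss of 2 is the factor 2 in [C2]. *)
have d0 : t / 2 * t ^+ 2 * t <= d.
  rewrite /d; apply: ler_pM; [nra|lra| |lra].
  apply: ler_pM; [lra|nra|lra|].
  by rewrite ler_pXn2r // nnegrE; lra.
have d1 : 0 < t / 2 * t ^+ 2 * t by rewrite !mulr_gt0 //; lra.
rewrite normrM normfV (gtr0_norm (lt_le_trans d1 d0)) ler_pdivrMr;
  last exact: lt_le_trans d0.
apply: (@le_trans _ _ (C2 * (t / 2 * t ^+ 2 * t))); last by rewrite ler_wpM2l.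
rewrite !normrM (ger0_norm (_ : 0 <= t)); last lra.
have -> : C2 * (t / 2 * t ^+ 2 * t) =
  t * (t * (1 + `|a|)) * (t * (1 + `|b|)) * (t * (1 + `|s|)).
  by rewrite /C2; field.
have tt : 0 <= t by lra.
apply: ler_pM; rewrite ?mulr_ge0 ?norm_addr_le //.
apply: ler_pM; rewrite ?mulr_ge0 ?norm_addr_le //.
apply: ler_pM; rewrite ?mulr_ge0 ?norm_addr_le //.
Qed.

(* Moments of the weight as series in [l], divided by the Beta integral. *)
Definition jacobi_moment_fps (k : nat) : fps R :=
  fun j => (-1) ^+ j / j`!%:R * jacobi_moment (k + j).

Lemma jacobi_moment_fps_deriv k :
  fps_deriv (jacobi_moment_fps k) = - jacobi_moment_fps k.+1.
Proof.
apply/funext => j; rewrite /fps_deriv fpsNE /jacobi_moment_fps addnS addSn.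
have f0 : j`!%:R != 0 :> R by rewrite pnatr_eq0 -lt0n fact_gt0.
have j0 : j.+1%:R != 0 :> R by rewrite pnatr_eq0.
rewrite -[LHS]mulr_natr factS natrM exprS; field.
by rewrite f0 addrC natr1 j0.
Qed.

(** The normalised moments lie between 0 and 1, so the exponential series at [|l|] dominates. *)
Lemma jacobi_moment_fps_summable l k : fps_summable l (jacobi_moment_fps k).
Proof.
have := is_cvg_series_exp_coeff `|l|.
apply: series_le_cvg => j; first exact: normr_ge0.
  by rewrite exp_coeff_ge0.
rewrite /= /jacobi_moment_fps /exp_coeff /=.
rewrite (normrM _ (l ^+ j)) (normrM _ (jacobi_moment _)) normrM !normrX normrN1.
rewrite expr1n mul1r normfV normr_nat mulrAC [leRHS]mulrC ler_piMr //.
by rewrite gtr0_norm ?jacobi_moment_gt0 // jacobi_moment_le1.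
Qed.

End Jacobi.

(** Taking the constant coefficient is a ring morphism, hence commutes with the recurrence. *)
Lemma fps_mixed_moment0E (R : comNzRingType) (al be mu : nat -> fps R) n k :
  mixed_moment al be mu n k 0%N =
  mixed_moment (fun j => al j 0%N) (fun j => be j 0%N) (fun j => mu j 0%N) n k.
Proof.
suff H : forall k, mixed_moment al be mu n k 0%N =
  mixed_moment (fun j => al j 0%N) (fun j => be j 0%N) (fun j => mu j 0%N) n k /\
  mixed_moment al be mu n.+1 k 0%N =
  mixed_moment (fun j => al j 0%N) (fun j => be j 0%N) (fun j => mu j 0%N) n.+1 k.
  by case: (H k).
elim: n {k} => [|n IH] k.
  by split=> //=; rewrite !fpsDE !fpsNE !fpsM0E.
split; first by case: (IH k).
move: (IH k) (IH k.+1) => [E1 E2] [_ E3].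
have SS (S : comNzRingType) (f g h : nat -> S) : mixed_moment f g h n.+2 k =
    mixed_moment f g h n.+1 k.+1 - f n.+1 * mixed_moment f g h n.+1 k -
    g n.+1 * mixed_moment f g h n k by [].
by rewrite !SS !fpsDE !fpsNE !fpsM0E E1 E2 E3.
Qed.

(** * Expansion of the sub-leading coefficient *)

Lemma fpsM1E (R : comNzRingType) (f g : fps R) :
  (f * g) 1%N = f 0%N * g 1%N + f 1%N * g 0%N.
Proof. by rewrite fpsME !big_ord_recl big_ord0 addr0. Qed.

Lemma fpsM2E (R : comNzRingType) (f g : fps R) :
  (f * g) 2 = f 0%N * g 2 + f 1%N * g 1%N + f 2 * g 0%N.
Proof. by rewrite fpsME !big_ord_recl big_ord0 addr0 addrA. Qed.

Section Coefficients.
Variables (R : realType) (a b : R).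

Definition alpha_fps (j : nat) : fps R :=
  toda_alpha (jacobi_alpha a b) (jacobi_beta a b) j.

Definition beta_fps (j : nat) : fps R :=
  toda_beta (jacobi_alpha a b) (jacobi_beta a b) j.

Definition subleading_fps (n : nat) : fps R := - \sum_(j < n) alpha_fps j.

Lemma beta_fps0 : beta_fps 0 = 0.
Proof. exact: toda_beta_eq0. Qed.

(** The sum of [beta_j - beta_(j+1)] telescopes, and [beta_0 = 0]. *)
Lemma subleading_fps_deriv n : fps_deriv (subleading_fps n) = beta_fps n.
Proof.
elim: n => [|n IH].
  rewrite /subleading_fps big_ord0 beta_fps0 fps_derivN.
  by apply/funext => m; rewrite /fps_deriv fpsNE fps0E mul0rn oppr0.
rewrite /subleading_fps big_ord_recr /= opprD fps_derivD.
rewrite -[X in fps_deriv X]/(subleading_fps n) IH fps_derivN toda_alpha_deriv.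
by rewrite opprB addrC subrK.
Qed.

Lemma subleading_fpsS n m : subleading_fps n m.+1 = beta_fps n m / m.+1%:R.
Proof.
rewrite -subleading_fps_deriv /fps_deriv -[X in X / _]mulr_natr mulfK //.
Qed.

Lemma subleading_fps0 n : subleading_fps n 0 = jacobi_sub a b n.
Proof.
elim: n => [|n IH].
  by rewrite /subleading_fps big_ord0 jacobi_sub0 fpsNE fps0E oppr0.
rewrite /subleading_fps big_ord_recr /= opprD fpsDE.
rewrite -[X in X 0%N + _]/(subleading_fps n) IH fpsNE /alpha_fps toda_alpha0.
by rewrite /jacobi_alpha opprB addrC subrK.
Qed.

Let al := jacobi_alpha a b.
Let be := jacobi_beta a b.

(* As [be 0 = 0], the junk value [0.-1 = 0] is harmless. *)
Let D j := al j.-1 - al j.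
(** For [j >= 1], [D j] and [S j] are the coefficients of order 0 and 1 of
    [alpha_(j-1) - alpha_j]. *)
Let S j := be j.-1 - be j *+ 2 + be j.+1.

Lemma beta_fps_at0 j : beta_fps j 0 = be j. Proof. by []. Qed.

Let alpha_at0 j : alpha_fps j 0 = al j. Proof. by []. Qed.

Let alpha_at1 j : alpha_fps j 1 = be j - be j.+1.
Proof. by rewrite /alpha_fps toda_alphaS divr1. Qed.

Lemma beta_fps_at1 j : beta_fps j 1 = be j * D j.
Proof. by rewrite /beta_fps toda_betaS divr1 fpsM0E. Qed.

Lemma beta_fps_at2 j : beta_fps j.+1 2 = be j.+1 * (S j.+1 + D j.+1 ^+ 2) / 2.
Proof.
rewrite {1}/beta_fps toda_betaS fpsM1E -/(beta_fps _) -!/(alpha_fps _).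
rewrite !fpsDE !fpsNE !alpha_at0 !alpha_at1 beta_fps_at1 beta_fps_at0 /S /D !succnK.
by congr (_ / _); ring.
Qed.

Lemma beta_fps_at3 j :
  beta_fps j.+1 3 = be j.+1 * ((be j * D j - be j.+1 * D j.+1 *+ 2 +
     be j.+2 * D j.+2) / 2 + D j.+1 * S j.+1 + (S j.+1 + D j.+1 ^+ 2) / 2 * D j.+1) / 3.
Proof.
have al2 i : alpha_fps i 2 = (be i * D i - be i.+1 * D i.+1) / 2.
  by rewrite /alpha_fps toda_alphaS -!/(beta_fps _) !beta_fps_at1.
rewrite {1}/beta_fps toda_betaS fpsM2E -/(beta_fps _) -!/(alpha_fps _).
rewrite !fpsDE !fpsNE !alpha_at0 !alpha_at1 !al2 beta_fps_at1 beta_fps_at2 beta_fps_at0.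
by rewrite /S /D !succnK; congr (_ / _); field.
Qed.

End Coefficients.

(** * The coefficients as rational functions, away from the zeros of the denominators *)

Section ClosedForms.
Variables (R : realType) (a b : R).

(** For [n = 1] the factors [A - 1] and [a + b + n] are both [a + b + 1], and cancelling them
    requires that it be nonzero. *)
Lemma jacobi_betaE n : -2 < a + b -> (n != 1%N) || (a + b + 1 != 0) ->
  jacobi_beta a b n = gcoef n a b / den2 n a b.
Proof.
move=> s2; case: n => [|[|n]] //=; first by rewrite /gcoef !mul0r.
move=> s1; rewrite /gcoef /den2 /Acoef.
field; do ?[apply/andP; split]; try (apply: lt0r_neq0; lra).
by move: s1; congr (_ != 0); ring.
Qed.

(** The second condition can fail only for [n = 0], where it reads [a + b != 0]. *)
Lemma jacobi_alpha_diff n : -2 < a + b -> Acoef n.+1 a b - 2 != 0 ->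
  jacobi_alpha a b n - jacobi_alpha a b n.+1 =
  2 * (a ^+ 2 - b ^+ 2) / ((Acoef n.+1 a b - 2) * Acoef n.+1 a b * (Acoef n.+1 a b + 2)).
Proof.
move=> s2; have n0 : 0 <= n%:R :> R by rewrite ler0n.
rewrite /jacobi_alpha /jacobi_sub /Acoef -[n.+2]addn2 -[n.+1]addn1 !natrD => A2.
field; do ?[apply/andP; split]; try (apply: lt0r_neq0; lra).
by move: A2; congr (_ != 0); ring.
Qed.

Variables (n : nat) (ha : -1 < a) (hb : -1 < b).

Let A := Acoef n.+1 a b.
(* [jacobi_beta] as a function of [A], using [n = (A - a - b) / 2]. *)
Let G (x : R) : R := (x - a - b) * (x + a - b) * (x - a + b) * (x + a + b) /
  (16 * ((x - 1) * x ^+ 2 * (x + 1))).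
(** Likewise for [jacobi_alpha (j-1) - jacobi_alpha j]; passing to a neighbouring index now shifts
    [x] by 2. *)
Let H (x : R) : R := 2 * (a ^+ 2 - b ^+ 2) / ((x - 2) * x * (x + 2)).

Let A_gt0 : 0 < A.
Proof.
move: ha hb => a1 b1; have n0 : 0 <= n%:R :> R by rewrite ler0n.
by rewrite /A /Acoef -natr1; lra.
Qed.

Let s2 : -2 < a + b. Proof. by move: ha hb => a1 b1; lra. Qed.

Let GE j : (j != 1%N) || (a + b + 1 != 0) ->
  jacobi_beta a b j = G (2 * j%:R + a + b).
Proof.
move=> hj; rewrite jacobi_betaE // /G /gcoef /den2 /Acoef.
set u := _ * _ ^+ 2 * _.
by rewrite (invfM 16) mulrA; congr (_ / _); field.
Qed.

Lemma coef2E : den2 n.+1 a b != 0 ->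
  beta_fps a b n.+1 0 = num2 n.+1 a b / den2 n.+1 a b.
Proof.
rewrite beta_fps_at0 => d0; apply: jacobi_betaE => //; case: (n) d0 => //= d0.
apply: contraNneq d0 => s1; rewrite /den2 /Acoef.
by rewrite (_ : 2 * 1%:R + a + b - 1 = 0) ?mul0r //; lra.
Qed.

Let A_neq0 : A != 0. Proof. exact: lt0r_neq0. Qed.

Let A1_neq0 : A + 1 != 0. Proof. by rewrite lt0r_neq0 // addr_gt0. Qed.
Let A2_neq0 : A + 2 != 0. Proof. by rewrite lt0r_neq0 // addr_gt0. Qed.
Let A3_neq0 : A + 3 != 0. Proof. by rewrite lt0r_neq0 // addr_gt0. Qed.
Let A4_neq0 : A + 4 != 0. Proof. by rewrite lt0r_neq0 // addr_gt0. Qed.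

(** Here and in [be_pred], when the index of [jacobi_beta] is 1 the hypothesis says exactly
    [a + b + 1 != 0]. *)
Let be_self : A - 1 != 0 -> jacobi_beta a b n.+1 = G A.
Proof.
rewrite /A => h; rewrite GE //; case: (n) h => //= h.
by apply: contraNneq h => s1; rewrite /Acoef; apply/eqP; lra.
Qed.

Let be_pred : A - 3 != 0 -> jacobi_beta a b n = G (A - 2).
Proof.
rewrite /A => h; rewrite GE.
  by congr (G _); rewrite /Acoef -natr1; ring.
case: (n) h => [|[|]] //= h.
by apply: contraNneq h => s1; rewrite /Acoef; apply/eqP; lra.
Qed.

Let be_succ : jacobi_beta a b n.+2 = G (A + 2).
Proof. by rewrite GE //; congr (G _); rewrite /A /Acoef -[n.+2]addn1 natrD; ring. Qed.

Let D_self : A - 2 != 0 -> jacobi_alpha a b n - jacobi_alpha a b n.+1 = H A.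
Proof. exact: jacobi_alpha_diff. Qed.

Let D_succ : jacobi_alpha a b n.+1 - jacobi_alpha a b n.+2 = H (A + 2).
Proof.
have AE : Acoef n.+2 a b = A + 2 by rewrite /A /Acoef -[n.+2]addn1 natrD; ring.
by rewrite jacobi_alpha_diff // AE // addrK.
Qed.

(** Stated for the product so as to include [n = 0]: there [0.-1 = 0] makes the difference zero, and
    [G (A - 2)] vanishes through its factor [x - a - b]. *)
Let D_pred : A - 4 != 0 -> A - 3 != 0 -> jacobi_beta a b n *
  (jacobi_alpha a b n.-1 - jacobi_alpha a b n) = G (A - 2) * H (A - 2).
Proof.
move=> h4 h3; rewrite be_pred //; move: h4; rewrite /A.
case: (n) => [|m] h4.
  by rewrite subrr mulr0 /G (_ : Acoef 1 a b - 2 - a - b = 0) ?mul0r // /Acoef; ring.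
have AE : Acoef m.+1 a b = Acoef m.+2 a b - 2.
  by rewrite /Acoef -[m.+2]addn1 natrD; ring.
rewrite jacobi_alpha_diff // ?AE // -AE.
by apply: contraNneq h4 => h; apply/eqP; lra.
Qed.

(** Eliminating the degree turns each formula below into a rational identity in [A], [a] and [b]. *)
Let t_E : n.+1%:R = (A - a - b) / 2 :> R.
Proof. by rewrite /A /Acoef; field. Qed.

Lemma coef3E : den3 n.+1 a b != 0 ->
  beta_fps a b n.+1 1 / 2 = num3 n.+1 a b / den3 n.+1 a b.
Proof.
move=> h.
have h1 : A - 1 != 0.
  by apply: contraNneq h => e; rewrite /den3 -/A e ?expr0n !(mul0r, mulr0).
have h2 : A - 2 != 0.
  by apply: contraNneq h => e; rewrite /den3 -/A e ?expr0n !(mul0r, mulr0).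
rewrite beta_fps_at1 succnK be_self // D_self //.
rewrite /num3 /gcoef /den3 -/A t_E /G /H.
by field; rewrite ?h1 ?h2 ?A_neq0 ?A1_neq0 ?A2_neq0.
Qed.

Lemma coef4E : den4 n.+1 a b != 0 ->
  beta_fps a b n.+1 2 / 3 = num4 n.+1 a b / den4 n.+1 a b.
Proof.
move=> h.
have h1 : A - 1 != 0.
  by apply: contraNneq h => e; rewrite /den4 -/A e ?expr0n !(mul0r, mulr0).
have h2 : A - 2 != 0.
  by apply: contraNneq h => e; rewrite /den4 -/A e ?expr0n !(mul0r, mulr0).
have h3 : A - 3 != 0.
  by apply: contraNneq h => e; rewrite /den4 -/A e ?expr0n !(mul0r, mulr0).
rewrite beta_fps_at2 succnK be_self // D_self // be_pred // be_succ.
rewrite /num4 /gcoef /Fcoef /den4 -/A t_E /G /H.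
by field; rewrite ?h1 ?h2 ?h3 ?A_neq0 ?A1_neq0 ?A2_neq0 ?A3_neq0.
Qed.

Lemma coef5E : den5 n.+1 a b != 0 ->
  beta_fps a b n.+1 3 / 4 = num5 n.+1 a b / den5 n.+1 a b.
Proof.
move=> h.
have h1 : A - 1 != 0.
  by apply: contraNneq h => e; rewrite /den5 -/A e ?expr0n !(mul0r, mulr0).
have h2 : A - 2 != 0.
  by apply: contraNneq h => e; rewrite /den5 -/A e ?expr0n !(mul0r, mulr0).
have h3 : A - 3 != 0.
  by apply: contraNneq h => e; rewrite /den5 -/A e ?expr0n !(mul0r, mulr0).
have h4 : A - 4 != 0.
  by apply: contraNneq h => e; rewrite /den5 -/A e ?expr0n !(mul0r, mulr0).
rewrite beta_fps_at3 !succnK D_pred // be_self // D_self // be_pred // be_succ D_succ.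
rewrite /num5 /gcoef /Ecoef /den5 -/A t_E /G /H.
by field; rewrite ?h1 ?h2 ?h3 ?h4 ?A_neq0 ?A1_neq0 ?A2_neq0 ?A3_neq0 ?A4_neq0.
Qed.

End ClosedForms.

(** * Continuity in the parameters and removable singularities *)

Section Continuity.
Variable R : realType.

(** Each coefficient is a polynomial in finitely many initial data, so convergence for each [j]
    separately is enough. *)
Lemma toda_cvg (T : Type) (F : set_system T) {FF : Filter F}
    (al be : T -> nat -> R) (al0 be0 : nat -> R) :
  (forall j, al x j @[x --> F] --> al0 j) ->
  (forall j, be x j @[x --> F] --> be0 j) -> forall m j,
  toda_alpha (al x) (be x) j m @[x --> F] --> toda_alpha al0 be0 j m /\
  toda_beta (al x) (be x) j m @[x --> F] --> toda_beta al0 be0 j m.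
Proof.
move=> Hal Hbe; elim/ltn_ind => -[_ j|m IH j]; first by split; [exact: Hal|exact: Hbe].
split.
  under eq_cvg do rewrite toda_alphaS.
  rewrite toda_alphaS; apply: cvgM; last exact: cvg_cst.
  by apply: cvgB; [case: (IH m (ltnSn m) j)|case: (IH m (ltnSn m) j.+1)].
under eq_cvg do rewrite toda_betaS fpsME.
rewrite toda_betaS fpsME; apply: cvgM; last exact: cvg_cst.
apply: (@cvg_big R _ +%R 0 xpredT (@add_continuous R)) => i _.
apply: cvgM; first by case: (IH i (ltn_ord i) j).
have im : (m - i < m.+1)%N by rewrite ltnS leq_subr.
by apply: cvgB; [case: (IH _ im j.-1)|case: (IH _ im j)].
Qed.

Variables (a b : R) (ha : -1 < a) (hb : -1 < b).

Let cvg_a : (p : R * R).1 @[p --> (a, b)] --> a. Proof. exact: cvg_fst. Qed.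
Let cvg_b : (p : R * R).2 @[p --> (a, b)] --> b. Proof. exact: cvg_snd. Qed.

Let cvg_A j : 2 * j%:R + p.1 + p.2 @[p --> (a, b)] --> 2 * j%:R + a + b.
Proof. by apply: cvgD => //; apply: cvgD => //; exact: cvg_cst. Qed.

(** At [j = 0] the denominator [a + b] may vanish, but the function is constantly zero; for [j >= 1]
    the denominator is positive. *)
Lemma jacobi_sub_cvg j :
  jacobi_sub p.1 p.2 j @[p --> (a, b)] --> jacobi_sub a b j.
Proof.
move: ha hb => a1 b1; case: j => [|j].
  under eq_cvg do rewrite jacobi_sub0.
  by rewrite jacobi_sub0; exact: cvg_cst.
have j0 : 0 <= j%:R :> R by rewrite ler0n.
apply: cvgN; apply: cvgM.
  by apply: cvgM; [exact: cvg_cst|apply: cvgD => //; exact: cvg_cst].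
apply: cvgV; last exact: cvg_A.
by apply: lt0r_neq0; rewrite -natr1; lra.
Qed.

Lemma jacobi_beta_cvg j :
  jacobi_beta p.1 p.2 j @[p --> (a, b)] --> jacobi_beta a b j.
Proof.
move: ha hb => a1 b1; case: j => [|[|j]]; first exact: cvg_cst.
  apply: cvgM.
    by do ?[exact: cvg_a|exact: cvg_b|exact: cvg_cst|apply: cvgM|apply: cvgD].
  apply: cvgV; first by rewrite mulf_neq0 ?expf_neq0 //; apply: lt0r_neq0; lra.
  rewrite expr2; under eq_cvg do rewrite expr2.
  by do ?[exact: cvg_a|exact: cvg_b|exact: cvg_cst|apply: cvgM|apply: cvgD].
have j0 : 0 <= j%:R :> R by rewrite ler0n.
have cA := @cvg_A j.+2.
apply: cvgM.
  by do ?[exact: cvg_a|exact: cvg_b|exact: cvg_cst|apply: cvgM|apply: cvgD].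
apply: cvgV.
  rewrite /den2 /Acoef -[j.+2]addn2 natrD !mulf_neq0 ?expf_neq0 //;
    by apply: lt0r_neq0; lra.
rewrite /den2 /Acoef expr2; under eq_cvg do rewrite /den2 /Acoef expr2.
by do ?[exact: cA|exact: cvg_cst|apply: cvgM|apply: cvgB|apply: cvgD].
Qed.

Lemma beta_fps_cvg j m :
  beta_fps p.1 p.2 j m @[p --> (a, b)] --> beta_fps a b j m.
Proof.
apply: (toda_cvg _ jacobi_beta_cvg m j).2 => i.
by apply: cvgB; exact: jacobi_sub_cvg.
Qed.

(** The left side of the hypothesis is continuous at [(a, b)] and agrees with [N / D] wherever [D]
    is nonzero, hence it is the continuous extension. *)
Lemma rational_value_coef (N D : R -> R -> R) n m (k : R) :
  (forall x y, -1 < x -> -1 < y -> D x y != 0 ->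
     beta_fps x y n m / k = N x y / D x y) ->
  rational_value N D a b (beta_fps a b n m / k).
Proof.
move=> H; split; first exact: H.
move=> _.
have c : beta_fps p.1 p.2 n m / k
    @[p --> within [set p : R * R | D p.1 p.2 != 0] (nbhs (a, b))]
    --> beta_fps a b n m / k.
  apply: cvg_trans (cvgM (@beta_fps_cvg n m) (cvg_cst k^-1)).
  by apply: cvg_app; exact: cvg_within.
apply: cvg_trans c; apply: near_eq_cvg.
(* Both parameters stay above -1 in a neighbourhood of [(a, b)]. *)
rewrite near_withinE; near=> p => /= Dp; apply: H => //.
  by near: p; exact: (cvgr_gt _ cvg_a).
by near: p; exact: (cvgr_gt _ cvg_b).
Unshelve. all: by end_near.
Qed.

End Continuity.

(** * Beta integrals and moments of the weight *)

Section OpenIntervalFTC.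
Variable R : realType.
Notation mu := (@lebesgue_measure R).
Notation I01 := (`]0, 1[%classic : set R).

Lemma measurable_oo_continuous (f : R -> R) :
  (forall x : R, 0 < x < 1 -> {for x, continuous f}) -> measurable_fun I01 f.
Proof.
move=> cf; apply: open_continuous_measurable_fun; first exact: interval_open.
by move=> x; rewrite inE /= in_itv /=; exact: cf.
Qed.

(** Starting at 1/3 keeps the intervals [[eps n, 1 - eps n]] nondegenerate. *)
Let eps (n : nat) : R := n.+3%:R^-1.

Let eps_gt0 n : 0 < eps n. Proof. by rewrite invr_gt0. Qed.

Let eps_lt n : eps n < 1 - eps n.
Proof.
have : eps n <= 3^-1 by rewrite lef_pV2 ?posrE // ler_nat.
by lra.
Qed.

Let eps_cvg : eps n @[n --> \oo] --> 0.
Proof.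
have := @cvg_harmonic R; rewrite -(cvg_shiftn 2) => h.
by under eq_fun do rewrite /eps -addn2; exact: h.
Qed.

Let piece n : set R := `[eps n, 1 - eps n].

Let piece_sub n x : piece n x -> 0 < x < 1.
Proof.
rewrite /piece /= in_itv /= => /andP[h1 h2].
by have := eps_gt0 n; lra.
Qed.

Let bigcup_piece : \bigcup_n piece n = I01.
Proof.
apply/seteqP; split=> x; first by case=> n _ /piece_sub; rewrite /= in_itv.
rewrite /= in_itv /= => /andP[x0 x1].
have : \forall n \near \oo, eps n < Num.min x (1 - x).
  by apply: (cvgr_lt _ eps_cvg); rewrite lt_min x0 subr_gt0.
case/filter_ex => n; rewrite lt_min => /andP[h1 h2]; exists n => //.
by rewrite /piece /= in_itv /=; lra.
Qed.

Section FTC.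
Variables (f F : R -> R) (l0 l1 : R).
Hypothesis dF : forall x : R, 0 < x < 1 -> is_derive x 1 F (f x).
Hypothesis cf : forall x : R, 0 < x < 1 -> {for x, continuous f}.
Hypothesis F0 : F x @[x --> 0^'+] --> l0.
Hypothesis F1 : F x @[x --> 1^'-] --> l1.

Let int_piece n :
  (\int[mu]_(x in piece n) (f x)%:E = (F (1 - eps n) - F (eps n))%:E)%E.
Proof.
have cF (x : R) : 0 < x < 1 -> F @ x --> F x.
  move=> /dF dx; apply: differentiable_continuous; apply/derivable1_diffP.
  exact: ex_derive.
have h := eps_gt0 n; have h' := eps_lt n.
rewrite EFinB; apply: continuous_FTC2 => //.
- apply: continuous_in_subspaceT => x; rewrite inE => /piece_sub; exact: cf.
- split.
  + move=> x; rewrite in_itv /= => hx.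
    by apply: ex_derive; apply: dF; lra.
  + by apply: cvg_at_right_filter; apply: cF; lra.
  + by apply: cvg_at_left_filter; apply: cF; lra.
- move=> x; rewrite in_itv /= => hx.
  rewrite derive1E; have dx : is_derive x 1 F (f x) by apply: dF; lra.
  exact: derive_val.
Qed.

Hypothesis f_ge0 : forall x : R, 0 < x < 1 -> 0 <= f x.

(** The compact pieces exhaust the interval: their integrals converge to the left side by
    monotonicity and to the right side by the one-sided limits of [F]. *)
Lemma ge0_integral_oo : (\int[mu]_(x in I01) (f x)%:E = (l1 - l0)%:E)%E.
Proof.
have mf := measurable_oo_continuous cf.
have c1 : (\int[mu]_(x in piece n) (f x)%:E @[n --> \oo] -->
    \int[mu]_(x in I01) (f x)%:E)%E.
  rewrite -bigcup_piece; apply: ge0_nondecreasing_set_cvg_integral.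
  - move=> m n mn; apply/subsetPset => x.
    rewrite /piece /= !in_itv /= => /andP[h1 h2].
    have : eps n <= eps m by rewrite lef_pV2 ?posrE // ler_nat.
    by lra.
  - by move=> n; exact: measurable_itv.
  - move=> n; apply/measurable_EFinP; apply: measurable_funS mf => //.
    by move=> x /piece_sub; rewrite /= in_itv.
  - by move=> n x /piece_sub hx; rewrite lee_fin f_ge0.
have c2 : (\int[mu]_(x in piece n) (f x)%:E @[n --> \oo] --> (l1 - l0)%:E)%E.
  under eq_fun do rewrite int_piece.
  apply: cvg_EFin; first exact: nearW.
  apply: cvgB.
    move/cvg_at_leftP : F1; apply; split=> [n|]; first by rewrite gtrBl.
    by rewrite -[X in _ --> X]subr0; apply: cvgB => //; exact: cvg_cst.
  by move/cvg_at_rightP : F0; apply; split.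
exact: cvg_unique c1 c2.
Qed.

Lemma ge0_integrable_oo : mu.-integrable I01 (EFin \o f).
Proof.
apply/integrableP; split.
  by apply/measurable_EFinP; exact: measurable_oo_continuous.
under eq_integral => x.
  rewrite inE /= in_itv /= => hx; rewrite /= ger0_norm ?f_ge0 //; over.
by rewrite ge0_integral_oo ltry.
Qed.

Lemma ge0_Rintegral_oo : \int[mu]_(x in I01) f x = l1 - l0.
Proof. by rewrite /Rintegral ge0_integral_oo. Qed.

End FTC.

(* The sign condition is only needed after adding [g], which is integrable. *)
Lemma Rintegral_oo_FTC (f F g G : R -> R) (l0 l1 m0 m1 : R) :
  (forall x : R, 0 < x < 1 -> is_derive x 1 F (f x)) ->
  (forall x : R, 0 < x < 1 -> {for x, continuous f}) ->
  F x @[x --> 0^'+] --> l0 -> F x @[x --> 1^'-] --> l1 ->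
  (forall x : R, 0 < x < 1 -> is_derive x 1 G (g x)) ->
  (forall x : R, 0 < x < 1 -> {for x, continuous g}) ->
  G x @[x --> 0^'+] --> m0 -> G x @[x --> 1^'-] --> m1 ->
  (forall x : R, 0 < x < 1 -> 0 <= g x) -> (forall x : R, 0 < x < 1 -> 0 <= f x + g x) ->
  \int[mu]_(x in I01) f x = l1 - l0.
Proof.
move=> dF cf F0 F1 dG cg G0 G1 g0 fg0.
have dFG (x : R) : 0 < x < 1 -> is_derive x 1 (F + G) ((f + g) x).
  by move=> hx; apply: is_deriveD; [exact: dF|exact: dG].
have cfg (x : R) : 0 < x < 1 -> {for x, continuous (f + g)}.
  by move=> hx; apply: continuousD; [exact: cf|exact: cg].
have H0 : (F + G) x @[x --> 0^'+] --> l0 + m0 by exact: cvgD.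
have H1 : (F + G) x @[x --> 1^'-] --> l1 + m1 by exact: cvgD.
have ig := ge0_integrable_oo dG cg G0 G1 g0.
have ifg := ge0_integrable_oo dFG cfg H0 H1 fg0.
have Efg := ge0_Rintegral_oo dFG cfg H0 H1 fg0.
have Eg := ge0_Rintegral_oo dG cg G0 G1 g0.
transitivity (\int[mu]_(x in I01) ((f + g) x - g x)).
  by apply: eq_Rintegral => x _; rewrite /= addrK.
by rewrite RintegralB // Efg Eg; ring.
Qed.

End OpenIntervalFTC.

(** * Integrability and recurrence of the Beta integral *)

Section BetaIntegral.
Variable R : realType.
Notation mu := (@lebesgue_measure R).
Notation I01 := (`]0, 1[%classic : set R).

Let mI : measurable (I01 : set (measurableTypeR R)).
Proof. exact: measurable_itv. Qed.

Let derive_powR (p x : R) : 0 < x < 1 ->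
  is_derive x 1 (fun y : R => y `^ p) (p * x `^ (p - 1)).
Proof. by case/andP=> x0 _; exact: is_derive1_powR. Qed.

Let derive_onem (p x : R) : x < 1 ->
  is_derive x 1 (fun y : R => (1 - y) `^ p) (- (p * (1 - x) `^ (p - 1))).
Proof.
move=> x1; have h : 0 < 1 - x by rewrite subr_gt0.
have d1 : is_derive x (1 : R) (fun y : R => 1 - y) (-1).
  have : is_derive x (1 : R) (cst (1 : R) - id) (0 - 1) by exact: is_deriveB.
  by rewrite sub0r.
have := @is_derive1_comp R (fun y : R => y `^ p) (fun y : R => 1 - y) x _ _
  (is_derive1_powR p h) d1.
by rewrite mulrN1.
Qed.

Let cont_powR (p x : R) : 0 < x -> {for x, continuous (fun y : R => y `^ p)}.
Proof.
move=> x0; apply: differentiable_continuous; apply/derivable1_diffP.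
by have h := is_derive1_powR p x0; exact: ex_derive.
Qed.

Let cont_onem (p x : R) : x < 1 -> {for x, continuous (fun y : R => (1 - y) `^ p)}.
Proof.
move=> x1; apply: differentiable_continuous; apply/derivable1_diffP.
by have h := derive_onem p x1; exact: ex_derive.
Qed.

Let powR_cvg1 (p : R) : x `^ p @[x --> (1 : R)^'-] --> (1 : R).
Proof.
apply: cvg_at_left_filter; have := @cont_powR p 1 ltr01.
by rewrite /prop_for /continuous_at powR1.
Qed.

Let onem_cvg0 (p : R) : (1 - x) `^ p @[x --> (0 : R)^'+] --> (1 : R).
Proof.
apply: cvg_at_right_filter; have := @cont_onem p 0 ltr01.
by rewrite /prop_for /continuous_at subr0 powR1.
Qed.

Let onem_cvg1 (p : R) : 0 < p -> (1 - x) `^ p @[x --> (1 : R)^'-] --> (0 : R).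
Proof.
move=> p0; apply/cvg_at_leftP => u [u1 uc].
have /cvg_at_rightP := powR_cvg0 p0; apply; split=> [n|]; first by rewrite subr_gt0.
by rewrite -[X in _ --> X](subrr 1); apply: cvgB => //; exact: cvg_cst.
Qed.

Let powR_integrable (p : R) : -1 < p ->
  mu.-integrable I01 (EFin \o (fun x : R => x `^ p)).
Proof.
move=> p1; have p0 : 0 < p + 1 by lra.
pose f (x : R) := (p + 1) * x `^ (p + 1 - 1).
have i : mu.-integrable I01 (EFin \o f).
  apply: (@ge0_integrable_oo _ f (fun x : R => x `^ (p + 1)) 0 1).
  - by move=> x; exact: derive_powR.
  - move=> x /andP[x0 _]; apply: cvgM; [exact: cvg_cst|exact: cont_powR].
  - exact: powR_cvg0.
  - exact: powR_cvg1.
  - by move=> x _; rewrite mulr_ge0 ?powR_ge0 // ltW.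
have := integrableZl mI (p + 1)^-1 i.
apply: eq_integrable => // x _.
by rewrite /f /= -EFinM mulKf ?addrK // gt_eqF.
Qed.

Let onem_deriv_ge0 (q x : R) : 0 < q -> 0 <= q * (1 - x) `^ (q - 1).
Proof. by move=> q0; rewrite mulr_ge0 ?powR_ge0 // ltW. Qed.

Let derive_onemN (p x : R) : x < 1 ->
  is_derive x 1 (fun y : R => - (1 - y) `^ p) (p * (1 - x) `^ (p - 1)).
Proof. by move=> /(derive_onem p) d; have := is_deriveN d; rewrite opprK. Qed.

Let onemN_cvg0 (p : R) : - (1 - x) `^ p @[x --> (0 : R)^'+] --> (-1 : R).
Proof. by apply: cvgN; exact: onem_cvg0. Qed.

Let onemN_cvg1 (p : R) : 0 < p -> - (1 - x) `^ p @[x --> (1 : R)^'-] --> (0 : R).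
Proof. by move=> p0; rewrite -oppr0; apply: cvgN; exact: onem_cvg1. Qed.

Let cont_onem_deriv (p x : R) : x < 1 ->
  {for x, continuous (fun y : R => p * (1 - y) `^ (p - 1))}.
Proof. by move=> x1; apply: cvgM; [exact: cvg_cst|exact: cont_onem]. Qed.

Let onem_integrable (p : R) : -1 < p ->
  mu.-integrable I01 (EFin \o (fun x : R => (1 - x) `^ p)).
Proof.
move=> p1; have p0 : 0 < p + 1 by lra.
pose f (x : R) := (p + 1) * (1 - x) `^ (p + 1 - 1).
have i : mu.-integrable I01 (EFin \o f).
  apply: (@ge0_integrable_oo _ f (fun x : R => - (1 - x) `^ (p + 1)) (-1) 0).
  - by move=> x /andP[_]; exact: derive_onemN.
  - by move=> x /andP[_]; exact: cont_onem_deriv.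
  - exact: onemN_cvg0.
  - exact: onemN_cvg1.
  - by move=> x _; exact: onem_deriv_ge0.
have := integrableZl mI (p + 1)^-1 i.
apply: eq_integrable => // x _.
by rewrite /f /= -EFinM mulKf ?addrK // gt_eqF.
Qed.

Definition beta_density (a b x : R) : R := x `^ a * (1 - x) `^ b.

Lemma beta_density_ge0 a b x : 0 <= beta_density a b x.
Proof. by rewrite mulr_ge0 ?powR_ge0. Qed.

Lemma beta_densityS a b x : 0 < x -> beta_density (a + 1) b x = x * beta_density a b x.
Proof.
move=> x0; rewrite /beta_density powRD ?(gt_eqF x0) ?implybT //.
by rewrite powRr1 ?ltW //; ring.
Qed.

Let beta_density_Sr a b (x : R) : x < 1 ->
  beta_density a (b + 1) x = (1 - x) * beta_density a b x.
Proof.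
move=> x1; have h : 0 < 1 - x by rewrite subr_gt0.
rewrite /beta_density powRD ?(gt_eqF h) ?implybT //.
by rewrite powRr1 ?ltW //; ring.
Qed.

Lemma beta_density_measurable a b : measurable_fun I01 (beta_density a b).
Proof.
apply: measurable_oo_continuous => x /andP[x0 x1].
by apply: cvgM; [exact: cont_powR|exact: cont_onem].
Qed.

(** Multiplying by [1 = (1 - x) + x] raises one exponent in each summand to a positive one, so
    [x ^ a + (1 - x) ^ b] is a majorant. *)
Lemma beta_density_integrable a b : -1 < a -> -1 < b ->
  mu.-integrable I01 (EFin \o beta_density a b).
Proof.
move=> a1 b1; have := integrableD mI (powR_integrable a1) (onem_integrable b1).
apply: (le_integrable mI).
  by apply/measurable_EFinP; exact: beta_density_measurable.
move=> x /=; rewrite in_itv /= => /andP[x0 x1]; rewrite lee_fin.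
have pa := powR_ge0 x a; have pb := powR_ge0 (1 - x) b.
rewrite !ger0_norm ?addr_ge0 ?beta_density_ge0 //.
have -> : beta_density a b x = beta_density a (b + 1) x + beta_density (a + 1) b x.
  by rewrite beta_densityS // beta_density_Sr //; ring.
rewrite /beta_density lerD //.
  rewrite ler_piMr //; apply: (@le_trans _ _ ((1 - x) `^ 0)); last by rewrite powRr0.
  by apply: ger_powR; lra.
rewrite ler_piMl //; apply: (@le_trans _ _ (x `^ 0)); last by rewrite powRr0.
by apply: ger_powR; lra.
Qed.

Definition beta_integral (a b : R) : R := \int[mu]_(x in I01) beta_density a b x.

(** The derivative of [x ^ (a+1) * (1 - x) ^ (b+1)] has integral zero, as this function vanishes at
    both ends. *)
Lemma beta_integralS a b : -1 < a -> -1 < b ->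
  (a + b + 2) * beta_integral (a + 1) b = (a + 1) * beta_integral a b.
Proof.
move=> a1 b1; have a0 : 0 < a + 1 by lra. have b0 : 0 < b + 1 by lra.
have a2 : -1 < a + 1 by lra. have b2 : -1 < b + 1 by lra.
pose f (x : R) := (a + 1) * beta_density a (b + 1) x - (b + 1) * beta_density (a + 1) b x.
have If : \int[mu]_(x in I01) f x = 0.
  rewrite -[RHS](subrr 0).
  (* The auxiliary [(b + 1) * (1 - x) ^ b] outweighs the negative term of [f] because
     [x ^ (a+1) <= 1]. *)
  apply: (@Rintegral_oo_FTC _ f (fun x : R => x `^ (a + 1) * (1 - x) `^ (b + 1))
    (fun x : R => (b + 1) * (1 - x) `^ (b + 1 - 1))
    (fun x : R => - (1 - x) `^ (b + 1)) 0 0 (-1) 0).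
  - move=> x hx; have /andP[x0 x1] := hx.
    have -> : f x = x `^ (a + 1) *: (- ((b + 1) * (1 - x) `^ (b + 1 - 1)) : R) +
        (1 - x) `^ (b + 1) *: ((a + 1) * x `^ (a + 1 - 1) : R).
      by rewrite /f /beta_density !addrK /GRing.scale /=; ring.
    exact: (is_deriveM (derive_powR (a + 1) hx) (derive_onem (b + 1) x1)).
  - move=> x /andP[x0 x1].
    apply: cvgB; apply: cvgM; do ?[exact: cvg_cst|apply: cvgM].
    + exact: cont_powR.
    + exact: cont_onem.
    + exact: cont_powR.
    + exact: cont_onem.
  - rewrite -[X in _ --> X](mul0r 1).
    by apply: cvgM; [exact: powR_cvg0|exact: onem_cvg0].
  - rewrite -[X in _ --> X](mul1r 0).
    by apply: cvgM; [exact: powR_cvg1|exact: onem_cvg1].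
  - by move=> x /andP[_]; exact: derive_onemN.
  - by move=> x /andP[_]; exact: cont_onem_deriv.
  - exact: onemN_cvg0.
  - exact: onemN_cvg1.
  - by move=> x _; exact: onem_deriv_ge0.
  - move=> x /andP[x0 x1]; rewrite /f addrK.
    have h : x `^ (a + 1) <= 1.
      apply: (@le_trans _ _ (x `^ 0)); last by rewrite powRr0.
      by apply: ger_powR; lra.
    have -> : (a + 1) * beta_density a (b + 1) x - (b + 1) * beta_density (a + 1) b x +
        (b + 1) * (1 - x) `^ b = (a + 1) * beta_density a (b + 1) x +
        (b + 1) * ((1 - x `^ (a + 1)) * (1 - x) `^ b).
      by rewrite /beta_density; ring.
    by rewrite addr_ge0 ?mulr_ge0 ?powR_ge0 ?beta_density_ge0 ?subr_ge0 // ltW.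
have i1 := beta_density_integrable a1 b1.
have i2 := beta_density_integrable a2 b1.
have fE : \int[mu]_(x in I01) f x = \int[mu]_(x in I01)
    ((a + 1) * beta_density a b x - (a + b + 2) * beta_density (a + 1) b x).
  apply: eq_Rintegral => x; rewrite inE /= in_itv /= => /andP[x0 x1].
  by rewrite /f beta_density_Sr // beta_densityS //; ring.
move: If; rewrite fE RintegralB //; last 2 first.
- exact: (integrableZl _ (a + 1) i1).
- exact: (integrableZl _ (a + b + 2) i2).
rewrite !RintegralZl // => /eqP; rewrite subr_eq0 => /eqP <-.
by [].
Qed.

End BetaIntegral.

(** * Moments of the weight as convergent series in [l] *)

Section WeightMoments.
Variables (R : realType) (a b l : R).
Hypotheses (ha : -1 < a) (hb : -1 < b).
Notation mu := (@lebesgue_measure R).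
Notation I01 := (`]0, 1[%classic : set R).

Let mI : measurable (I01 : set (measurableTypeR R)).
Proof. exact: measurable_itv. Qed.

Let Z := beta_integral a b.

Lemma beta_integral_moment k :
  beta_integral (a + k%:R) b = Z * jacobi_moment a b k.
Proof.
elim: k => [|k IH]; first by rewrite addr0 /jacobi_moment !rising0 divr1 mulr1.
move: ha hb => a1 b1; have k0 : 0 <= k%:R :> R by rewrite ler0n.
have h : a + b + 2 + k%:R != 0 by apply: lt0r_neq0; lra.
apply: (mulfI h); rewrite [RHS]mulrCA jacobi_momentS // [RHS]mulrCA -IH.
have := @beta_integralS R (a + k%:R) b; rewrite -[k.+1%:R]natr1 (addrA a).
have -> : a + k%:R + b + 2 = a + b + 2 + k%:R by ring.
by move=> -> //; [congr (_ * _); ring|lra].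
Qed.

Let expn_density (k : nat) (x : R) : 0 < x ->
  x ^+ k * beta_density a b x = beta_density (a + k%:R) b x.
Proof.
move=> x0; elim: k => [|k IH]; first by rewrite expr0 mul1r addr0.
by rewrite exprS -mulrA IH -natr1 addrA beta_densityS.
Qed.

Let expn_density_integrable k :
  mu.-integrable I01 (EFin \o (fun x => x ^+ k * beta_density a b x)).
Proof.
have k0 : 0 <= k%:R :> R by rewrite ler0n.
have : mu.-integrable I01 (EFin \o beta_density (a + k%:R) b).
  by apply: beta_density_integrable => //; apply: lt_le_trans ha _; rewrite lerDl.
apply: eq_integrable => // x; rewrite inE /= in_itv /= => /andP[x0 _].
by rewrite expn_density.
Qed.

Let expn_density_integral k :
  \int[mu]_(x in I01) (x ^+ k * beta_density a b x) = Z * jacobi_moment a b k.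
Proof.
rewrite -beta_integral_moment; apply: eq_Rintegral => x.
by rewrite inE /= in_itv /= => /andP[x0 _]; rewrite expn_density.
Qed.

Let partial k N (x : R) :=
  x ^+ k * beta_density a b x * series (exp_coeff (- (l * x))) N.

Let partialS k N : partial k N.+1 = (fun x => partial k N x +
  (-1) ^+ N / N`!%:R * l ^+ N * (x ^+ (k + N) * beta_density a b x)).
Proof.
apply/funext => x; rewrite /partial seriesSr mulrDr; congr (_ + _).
by rewrite /exp_coeff /= -mulN1r -mulNr mulN1r !exprMn exprD -[- l]mulN1r exprMn; ring.
Qed.

Let partial_integral k N :
  mu.-integrable I01 (EFin \o partial k N) /\
  \int[mu]_(x in I01) partial k N x =
    Z * series (fun m => jacobi_moment_fps a b k m * l ^+ m) N.
Proof.
elim: N => [|N [IH1 IH2]].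
  have E : partial k 0 = cst 0.
    by apply/funext => x; rewrite /partial /series /= big_geq // mulr0.
  rewrite E; split; first exact: integrable0.
  by rewrite Rintegral_cst // mul0r /series /= big_geq // mulr0.
have i := integrableZl mI ((-1) ^+ N / N`!%:R * l ^+ N) (expn_density_integrable (k + N)).
rewrite partialS; split; first exact: (integrableD mI IH1 i).
rewrite RintegralD // IH2 RintegralZl // expn_density_integral seriesSr mulrDr.
by congr (_ + _); rewrite /jacobi_moment_fps; ring.
Qed.

Let partial_bound k N (x : R) : 0 < x < 1 ->
  `|partial k N x| <= expR `|l| * beta_density a b x.
Proof.
move=> /andP[x0 x1]; rewrite /partial 2!normrM.
rewrite [`|beta_density _ _ _|]ger0_norm ?beta_density_ge0 //.
have xk : `|x ^+ k| <= 1.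
  by rewrite normrX exprn_ile1 // ger0_norm ltW.
have s1 : `|series (exp_coeff (- (l * x))) N| <= expR `|l|.
  apply: (@le_trans _ _ (series (exp_coeff `|l|) N)).
    apply: le_trans (ler_norm_sum _ _ _) _; apply: ler_sum => i _.
    rewrite /exp_coeff /= normrM normfV normr_nat normrX ler_wpM2r ?invr_ge0 //.
    rewrite normrN normrM; apply: lerXn2r; rewrite ?nnegrE ?mulr_ge0 //.
    by rewrite ler_piMr // gtr0_norm // ltW.
  apply: nondecreasing_cvgn_le; last exact: is_cvg_series_exp_coeff.
  by apply: nondecreasing_series => i _ _; rewrite exp_coeff_ge0.
rewrite mulrC; apply: ler_pM => //; first by rewrite mulr_ge0 ?beta_density_ge0.
by rewrite ler_piMl ?beta_density_ge0.
Qed.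

Definition weight_moment (k : nat) : R :=
  \int[mu]_(x in I01) (x ^+ k * weight a b l x).

Let weight_cvg k (x : R) :
  partial k N x @[N --> \oo] --> x ^+ k * weight a b l x.
Proof.
rewrite /weight -/(beta_density a b x) mulrA.
by apply: cvgM; [exact: cvg_cst|exact: is_cvg_series_exp_coeff].
Qed.

(** The exponential series is integrated term by term by dominated convergence, with majorant
    [exp |l| * x ^ a * (1 - x) ^ b]. *)
Let weight_dct k :
  mu.-integrable I01 (EFin \o (fun x => x ^+ k * weight a b l x)) /\
  (\int[mu]_(x in I01) (partial k N x)%:E @[N --> \oo] -->
   \int[mu]_(x in I01) (x ^+ k * weight a b l x)%:E)%E.
Proof.
have ig := integrableZl mI (expR `|l|) (beta_density_integrable ha hb).
have [] := @dominated_convergence _ _ _ mu I01 mI (fun N x => (partial k N x)%:E)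
  (fun x => (x ^+ k * weight a b l x)%:E)
  (fun x => (expR `|l|)%:E * (beta_density a b x)%:E)%E.
- by move=> N; have [/integrableP[]] := partial_integral k N.
- apply/measurable_EFinP; apply: (measurable_fun_cvg (h := partial k)).
    by move=> N; apply/measurable_EFinP; have [/integrableP[]] := partial_integral k N.
  by move=> x _; exact: weight_cvg.
- by apply: aeW => x _; apply: cvg_EFin; [exact: nearW|exact: weight_cvg].
- exact: ig.
- apply: aeW => x N /=; rewrite in_itv /= => hx.
  by rewrite -EFinM lee_fin partial_bound.
by move=> h1 _ h2; split.
Qed.

Lemma weight_integrable k :
  mu.-integrable I01 (EFin \o (fun x => x ^+ k * weight a b l x)).
Proof. by case: (weight_dct k). Qed.

Lemma weight_momentE k :
  weight_moment k = Z * fps_eval l (jacobi_moment_fps a b k).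
Proof.
have [ik ck] := weight_dct k.
have c1 : \int[mu]_(x in I01) partial k N x @[N --> \oo] --> weight_moment k.
  apply: (fine_cvg (f := fun N => \int[mu]_(x in I01) (partial k N x)%:E)%E).
  by rewrite /weight_moment /Rintegral fineK //; exact: integrable_fin_num.
have c2 : \int[mu]_(x in I01) partial k N x @[N --> \oo] -->
    Z * fps_eval l (jacobi_moment_fps a b k).
  under eq_cvg do rewrite (partial_integral k _).2.
  apply: cvgM; first exact: cvg_cst.
  by apply: fps_eval_cvg; exact: jacobi_moment_fps_summable.
exact: cvg_unique c1 c2.
Qed.

End WeightMoments.

(** * Orthogonal polynomials *)

Section ThreeTermRecurrence.
Variables (R : comNzRingType) (A B : nat -> R).

Fixpoint recurrence_poly n : {poly R} :=
  if n is n1.+1 then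
    recurrence_poly n1 * 'X - A n1 *: recurrence_poly n1 -
    B n1 *: (if n1 is n2.+1 then recurrence_poly n2 else 0)
  else 1.

Lemma recurrence_poly_size n :
  (size (recurrence_poly n) <= n.+1)%N /\ (recurrence_poly n)`_n = 1.
Proof.
suff H : forall m, (m <= n)%N ->
    (size (recurrence_poly m) <= m.+1)%N /\ (recurrence_poly m)`_m = 1 by exact: H.
elim: n => [|n IH] m; first by rewrite leqn0 => /eqP ->; rewrite size_poly1 coef1.
rewrite leq_eqVlt => /predU1P[->|]; last by rewrite ltnS => /IH.
have [sn cn] := IH n (leqnn n).
pose p' : {poly R} := if n is n2.+1 then recurrence_poly n2 else 0.
have [s' c'] : (size p' <= n)%N /\ p'`_n.+1 = 0.
  rewrite /p' {p'}; case: n IH {sn cn} => [|n] IH; first by rewrite size_poly0 coef0.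
  have [s1 _] := IH n (leqnSn n); split=> //.
  by rewrite nth_default // (leq_trans s1) // leqW.
rewrite /= -/p'; split.
  have b1 : (size (recurrence_poly n * 'X)%R <= n.+2)%N.
    by rewrite (leq_trans (size_polyMleq _ _)) // size_polyX addn2.
  have b2 : (size (A n *: recurrence_poly n) <= n.+2)%N.
    by rewrite (leq_trans (size_scale_leq _ _)) // leqW.
  have b3 : (size (B n *: p') <= n.+2)%N.
    by rewrite (leq_trans (size_scale_leq _ _)) // (leq_trans s') // leqW.
  rewrite (leq_trans (size_polyD _ _)) // geq_max size_polyN b3 andbT.
  by rewrite (leq_trans (size_polyD _ _)) // geq_max size_polyN b1 b2.
rewrite !coefB !coefZ coefMX /= cn c' mulr0 subr0.
by rewrite (nth_default _ sn) mulr0 subr0.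
Qed.

Lemma size_recurrence_poly n : size (recurrence_poly n) = n.+1.
Proof.
have [s c] := recurrence_poly_size n; apply/eqP; rewrite eqn_leq s /= ltnNge.
by apply/negP => h; have /eqP := c; rewrite nth_default // eq_sym oner_eq0.
Qed.

Lemma recurrence_poly_monic n : recurrence_poly n \is monic.
Proof.
apply/monicP; rewrite /lead_coef size_recurrence_poly.
by have [_] := recurrence_poly_size n.
Qed.

(** Each step subtracts [A n] from the sub-leading coefficient; the term in [B n] has too low a
    degree to contribute. *)
Lemma recurrence_poly_subleading n :
  (recurrence_poly n.+1)`_n = - \sum_(j < n.+1) A j.
Proof.
elim: n => [|n IH].
  by rewrite /= scaler0 subr0 mul1r coefB coefX coefZ coef1 mulr1 big_ord1 sub0r.
have [s _] := recurrence_poly_size n; have [_ c] := recurrence_poly_size n.+1.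
have -> : recurrence_poly n.+2 = recurrence_poly n.+1 * 'X -
  A n.+1 *: recurrence_poly n.+1 - B n.+1 *: recurrence_poly n by [].
rewrite !coefB !coefZ coefMX IH c (nth_default _ s).
by rewrite mulr0 subr0 mulr1 [in RHS]big_ord_recr opprD.
Qed.

End ThreeTermRecurrence.

(** Evaluation respects sums and products of summable series, hence the recurrence; summability is
    propagated along with it. *)
Lemma fps_eval_mixed_moment (R : realType) (l : R) (al be mu : nat -> fps R) :
  (forall j, fps_summable l (al j)) -> (forall j, fps_summable l (be j)) ->
  (forall j, fps_summable l (mu j)) -> forall n k,
  fps_summable l (mixed_moment al be mu n k) /\
  fps_eval l (mixed_moment al be mu n k) =
  mixed_moment (fun j => fps_eval l (al j)) (fun j => fps_eval l (be j))
    (fun j => fps_eval l (mu j)) n k.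
Proof.
move=> sa sb sm n.
suff H : forall m, (m <= n)%N -> forall k,
  fps_summable l (mixed_moment al be mu m k) /\
  fps_eval l (mixed_moment al be mu m k) =
  mixed_moment (fun j => fps_eval l (al j)) (fun j => fps_eval l (be j))
    (fun j => fps_eval l (mu j)) m k by exact: H.
elim: n => [|n IH] m; first by rewrite leqn0 => /eqP -> k; split.
rewrite leq_eqVlt => /predU1P[->|]; last by rewrite ltnS => /IH.
move=> k; have [s1 e1] := IH n (leqnn n) k; have [s2 e2] := IH n (leqnn n) k.+1.
have [s3 e3] : fps_summable l (if n is n2.+1 then mixed_moment al be mu n2 k else 0) /\
  fps_eval l (if n is n2.+1 then mixed_moment al be mu n2 k else 0) =
  (if n is n2.+1 then mixed_moment (fun j => fps_eval l (al j))
    (fun j => fps_eval l (be j)) (fun j => fps_eval l (mu j)) n2 k else 0).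
  case: n IH {s1 e1 s2 e2} => [|n] IH; last exact: IH.
  by split; [exact: fps_summable0|exact: fps_eval0].
have t1 := fps_summableM (sa n) s1; have t2 := fps_summableM (sb n) s3.
have u1 := fps_summableN t1; have u2 := fps_summableN t2.
have v := fps_summableD s2 u1.
split; first exact: fps_summableD.
by rewrite /= !fps_evalD // !fps_evalN // !fps_evalM // e1 e2 e3.
Qed.

(** * The integration functional on polynomials and its definiteness *)

Section WeightFunctional.
Variables (R : realType) (a b l : R).
Hypotheses (ha : -1 < a) (hb : -1 < b).
Notation mu := (@lebesgue_measure R).
Notation I01 := (`]0, 1[%classic : set R).

Let mI : measurable (I01 : set (measurableTypeR R)).
Proof. exact: measurable_itv. Qed.

Definition weight_functional (P : {poly R}) : R :=
  \int[mu]_(x in I01) (P.[x] * weight a b l x).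

Lemma weight_poly_integrable (P : {poly R}) :
  mu.-integrable I01 (EFin \o (fun x => P.[x] * weight a b l x)).
Proof.
have : mu.-integrable I01 (fun x =>
    (\sum_(i < size P) (P`_i)%:E * (x ^+ i * weight a b l x)%:E)%E).
  apply: integrable_sum => // i _.
  exact: (integrableZl mI _ (weight_integrable l ha hb i)).
apply: eq_integrable => // x _.
rewrite /= horner_coef mulr_suml -sumEFin; apply: eq_bigr => i _.
by rewrite -EFinM mulrA.
Qed.

Lemma weight_functionalD P Q :
  weight_functional (P + Q) = weight_functional P + weight_functional Q.
Proof.
rewrite /weight_functional -RintegralD //; try exact: weight_poly_integrable.
by apply: eq_Rintegral => x _; rewrite hornerD mulrDl.
Qed.

Lemma weight_functionalZ c P :
  weight_functional (c *: P) = c * weight_functional P.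
Proof.
rewrite /weight_functional -RintegralZl //; last exact: weight_poly_integrable.
by apply: eq_Rintegral => x _; rewrite hornerZ -mulrA.
Qed.

Lemma weight_functional0 : weight_functional 0 = 0.
Proof. by rewrite -(scale0r 0) weight_functionalZ mul0r. Qed.

Lemma weight_functionalB P Q :
  weight_functional (P - Q) = weight_functional P - weight_functional Q.
Proof. by rewrite weight_functionalD -scaleN1r weight_functionalZ mulN1r. Qed.

(** Links the formal recurrence to integrals: by linearity, integrating [x ^ k] times the polynomial
    recurrence gives that of the mixed moments. *)
Lemma weight_functional_mixed A B n k :
  weight_functional (recurrence_poly A B n * 'X^k) =
  mixed_moment A B (weight_moment a b l) n k.
Proof.
suff H : forall m, (m <= n)%N -> forall k,
  weight_functional (recurrence_poly A B m * 'X^k) =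
  mixed_moment A B (weight_moment a b l) m k by exact: H.
elim: n {k} => [|n IH] m.
  rewrite leqn0 => /eqP -> k; rewrite mul1r.
  by apply: eq_Rintegral => x _; rewrite hornerXn.
rewrite leq_eqVlt => /predU1P[-> k|]; last by rewrite ltnS => /IH.
rewrite /= !mulrBl weight_functionalB weight_functionalB -!scalerAl.
rewrite !weight_functionalZ -mulrA -exprS !IH //; congr (_ - _ * _).
by case: n IH => [|n] IH; [rewrite mul0r weight_functional0|exact: IH].
Qed.

Lemma weight_functional_expansion (P Q : {poly R}) n : (size Q <= n)%N ->
  weight_functional (P * Q) = \sum_(i < n) Q`_i * weight_functional (P * 'X^i).
Proof.
move=> sQ; have -> : Q = \sum_(i < n) Q`_i *: 'X^i.
  rewrite -[LHS](take_poly_id sQ) /take_poly poly_def.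
  by apply: eq_bigr.
rewrite mulr_sumr (big_morph _ weight_functionalD weight_functional0).
apply: eq_bigr => i _; rewrite -scalerAr weight_functionalZ; congr (_ * _).
rewrite coef_sum (bigD1 i) //= coefZ coefXn eqxx mulr1 big1 ?addr0 // => j ji.
by rewrite coefZ coefXn eq_sym [_ == _](negbTE ji) mulr0.
Qed.

Lemma weight_functionalE (P Q : {poly R}) :
  \int[mu]_(x in `[0, 1]) (P.[x] * Q.[x] * weight a b l x) =
  weight_functional (P * Q).
Proof.
rewrite /weight_functional /Rintegral integral_itv_bndoo.
  by congr fine; apply: eq_integral => x _; rewrite hornerM.
have := weight_poly_integrable (P * Q) => /integrableP[+ _].
by apply: eq_measurable_fun => x _ /=; rewrite hornerM.
Qed.

(** The integrand is nonnegative, so it vanishes almost everywhere; the weight being positive,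
    almost every point is a root of [Q]. A nonzero [Q] has finitely many roots, and then the
    interval of length 1 would be null. *)
Lemma weight_functional_definite (Q : {poly R}) : weight_functional (Q * Q) = 0 -> Q = 0.
Proof.
move=> Q0; apply/eqP; apply: contraT => Qn0.
have iQ := weight_poly_integrable (Q * Q).
have w0 (x : R) : 0 < x < 1 -> 0 < weight a b l x.
  by case/andP=> x0 x1; rewrite !mulr_gt0 ?powR_gt0 ?subr_gt0 ?expR_gt0.
have ge0 (x : R) : I01 x -> 0 <= (Q * Q).[x] * weight a b l x.
  by rewrite /= in_itv /= => /w0/ltW ?; rewrite hornerM mulr_ge0 // -expr2 sqr_ge0.
have I0 : (\int[mu]_(x in I01) `|((Q * Q).[x] * weight a b l x)%:E| = 0)%E.
  transitivity (\int[mu]_(x in I01) ((Q * Q).[x] * weight a b l x)%:E)%E.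
    by apply: eq_integral => x; rewrite inE => /ge0 h; rewrite /= ger0_norm.
  have fn := integrable_fin_num mI iQ.
  by rewrite -[LHS](fineK fn) -[fine _]/(weight_functional (Q * Q)) Q0.
have [miQ _] := integrableP _ _ _ iQ.
have [N [mN N0 sN]] := (ae_eq_integral_abs mu mI miQ).1 I0.
have fin_roots : finite_set [set x | root Q x].
  apply: contrapT => /(infinite_set_fset (size Q)) [B sB].
  rewrite leqNgt => /negP; apply; apply: max_poly_roots => //;
    last exact: finmap.fset_uniq.
  by apply/allP => x xB; exact: sB.
have mA : measurable ([set x | root Q x] : set (measurableTypeR R)).
  apply: countable_measurable; first exact: measurable_set1.
  exact: finite_set_countable fin_roots.
have A0 := countable_lebesgue_measure0 (finite_set_countable fin_roots).
have : mu.-negligible I01.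
  apply: (@negligibleS _ _ _ mu (N `|` [set x | root Q x])).
    move=> x xI; have [xN|xN] := pselect (N x); [by left|right].
    have /= E : ((Q * Q).[x] * weight a b l x)%:E = 0%E.
      by apply: contrapT => h; apply: xN; apply: sN => /= /(_ xI).
    have wx : 0 < weight a b l x by apply: w0; move: xI; rewrite /= in_itv.
    by case: E => /eqP; rewrite mulf_eq0 (gt_eqF wx) orbF hornerM mulf_eq0 orbb.
  apply: negligibleU; first by exists N; split.
  by exists [set x | root Q x]; split.
move=> /(negligibleP mu mI) h.
have : (0 = 1%:E :> \bar R)%E.
  rewrite -[LHS]h [LHS]lebesgue_measure_itv /= lte_fin ltr01.
  by rewrite oppr0 adde0.
by move=> /eqP; rewrite eqe eq_sym oner_eq0.
Qed.

End WeightFunctional.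

(** Lets the Beta integral be factored out of the moments without affecting orthogonality. *)
Lemma mixed_momentZ (R : comNzRingType) (A B M : nat -> R) c n k :
  mixed_moment A B (fun j => c * M j) n k = c * mixed_moment A B M n k.
Proof.
suff H : forall m, (m <= n)%N -> forall k,
  mixed_moment A B (fun j => c * M j) m k = c * mixed_moment A B M m k by exact: H.
elim: n {k} => [|n IH] m; first by rewrite leqn0 => /eqP ->.
rewrite leq_eqVlt => /predU1P[-> k|]; last by rewrite ltnS => /IH.
rewrite /= !IH // !mulrBr; congr (_ - _ - _); first by rewrite mulrCA.
by case: n IH => [|n] IH; [rewrite !mulr0|rewrite IH // mulrCA].
Qed.

(** The leading terms cancel in [P - Q], which is therefore a test polynomial for both and
    orthogonal to itself. *)
Lemma is_monic_op_unique (R : realType) n (a b l : R) (P Q : {poly R}) :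
  -1 < a -> -1 < b -> is_monic_op n a b l P -> is_monic_op n a b l Q -> P = Q.
Proof.
move=> ha hb [mP sP oP] [mQ sQ oQ].
have sD : (size (P - Q)%R <= n)%N.
  apply/leq_sizeP => j nj; rewrite coefB.
  move: nj; rewrite leq_eqVlt => /predU1P[<-|nj].
    move/monicP: mP; move/monicP: mQ; rewrite /lead_coef sP sQ /= => -> ->.
    exact: subrr.
  by rewrite !nth_default ?subrr // ?sP ?sQ.
apply/eqP; rewrite -subr_eq0; apply/eqP.
apply: (@weight_functional_definite _ a b l) => //.
rewrite {1}(_ : P - Q = P + (- 1) *: Q); last by rewrite scaleN1r.
rewrite mulrDl weight_functionalD // -scalerAl weight_functionalZ //.
by rewrite -!weight_functionalE // oP // oQ // mulr0 addr0.
Qed.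

(** * From the formal solution to the orthogonal polynomials *)

Section ConvergentRecurrence.
Variables (R : realType) (a b : R).
Hypotheses (ha : -1 < a) (hb : -1 < b).

Lemma jacobi_toda_summable : exists2 r : R, 0 < r & forall l, `|l| < r ->
  (forall j, fps_summable l (alpha_fps a b j)) /\
  (forall j, fps_summable l (beta_fps a b j)).
Proof.
have [C HC] := jacobi_bounded ha hb.
have C0 : 0 <= C by apply: le_trans (HC 0%N).1.
(* This [rho] meets both lower bounds of [toda_bound]; the common radius is its inverse. *)
pose rho := 2 + C * 2; have rho2 : 2 <= rho by rewrite /rho; lra.
have rho0 : 0 < rho by lra.
have Cr : C * 2 <= rho by rewrite /rho; lra.
have bound := @toda_bound _ _ _ C rho (fun j => (HC j).1) (fun j => (HC j).2) rho2 Cr.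
exists rho^-1; first by rewrite invr_gt0.
move=> l hl; have lr : rho * `|l| < 1 by rewrite -ltr_pdivlMl // mulr1.
by split=> j; apply: (@fps_summable_geometric _ l _ C rho) => //; try exact: ltW;
  move=> m; case: (bound m j).
Qed.

Variable l : R.
Hypothesis sa : forall j, fps_summable l (alpha_fps a b j).
Hypothesis sb : forall j, fps_summable l (beta_fps a b j).

Let A j := fps_eval l (alpha_fps a b j).
Let B j := fps_eval l (beta_fps a b j).

Lemma fps_eval_subleading n : fps_summable l (subleading_fps a b n) /\
  fps_eval l (subleading_fps a b n) = - \sum_(j < n) A j.
Proof.
suff [s e] : fps_summable l (\sum_(j < n) alpha_fps a b j) /\
    fps_eval l (\sum_(j < n) alpha_fps a b j) = \sum_(j < n) A j.
  by split; [exact: fps_summableN|rewrite fps_evalN // e].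
elim: n => [|n [s e]].
  by rewrite !big_ord0; split; [exact: fps_summable0|exact: fps_eval0].
rewrite !big_ord_recr /=; split; first exact: fps_summableD.
by rewrite fps_evalD // e.
Qed.

(** It suffices to test on monomials [x ^ i] with [i < n]. Up to the Beta integral, the result is
    the value at [l] of a mixed moment that is zero as a formal series. *)
Lemma recurrence_poly_orthogonal n : is_monic_op n a b l (recurrence_poly A B n).
Proof.
split; [exact: recurrence_poly_monic|exact: size_recurrence_poly|move=> Q sQ].
rewrite weight_functionalE // (weight_functional_expansion l ha hb _ sQ) big1 // => i _.
rewrite weight_functional_mixed //.
have -> : weight_moment a b l =
    (fun k => beta_integral a b * fps_eval l (jacobi_moment_fps a b k)).
  by apply/funext => k; exact: weight_momentE.
rewrite mixed_momentZ.
have [_ <-] := fps_eval_mixed_moment sa sb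
  (fun k => @jacobi_moment_fps_summable _ _ _ ha hb l k) n i.
rewrite toda_orthogonal ?fps_eval0 ?mulr0 //.
  exact: jacobi_moment_fps_deriv.
move=> m; rewrite fps_mixed_moment0E.
have -> : (fun j => jacobi_moment_fps a b j 0%N) = jacobi_moment a b.
  by apply/funext => j; rewrite /jacobi_moment_fps expr0 fact0 divr1 mul1r addn0.
exact: jacobi_mixed_moment0.
Qed.

(** For [n = 0] the index [n.-1] would pick the leading coefficient 1, whereas the series is
    zero. *)
Lemma subleadingE n : (0 < n)%N ->
  subleading n a b l = fps_eval l (subleading_fps a b n).
Proof.
case: n => // n _; rewrite /subleading /monic_op.
rewrite (@xget_unique _ 0 _ (recurrence_poly A B n.+1)).
- by rewrite recurrence_poly_subleading (fps_eval_subleading _).2.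
- exact: recurrence_poly_orthogonal.
- move=> P hP; apply: is_monic_op_unique hP _ => //.
  exact: recurrence_poly_orthogonal.
Qed.

End ConvergentRecurrence.

Theorem theorem4p4 (R : realType) (n : nat) (a b : R)
    (ha : -1 < a) (hb : -1 < b) (ha0 : a != 0) (hb0 : b != 0) (hn : (1 <= n)%N) :
  exists c : nat -> R,
    (exists2 r : R, 0 < r &
      forall l : R, `|l| < r ->
        let S : nat -> R := fun N => \sum_(1 <= m < N) c m * (- l) ^+ m in
        cvgn S /\
        sigma n a b l = - (n%:R * (n%:R + b)) + n%:R * l - limn S) /\
    [/\ c 1%N = - (n%:R * (a + n%:R) / Acoef n a b),
        rational_value (num2 n) (den2 n) a b (c 2%N),
        rational_value (num3 n) (den3 n) a b (c 3%N),
        rational_value (num4 n) (den4 n) a b (c 4%N) &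
        rational_value (num5 n) (den5 n) a b (c 5%N)].
Proof.
(* In [sigma] the coefficient [p(n, -l)] is multiplied by [l = - (- l)]: this shifts its expansion
   in powers of [- l] by one and gives the minus sign before the sum. *)
pose c m := subleading_fps a b n m.-1.
have cS m : c m.+2 = beta_fps a b n m / m.+1%:R by exact: subleading_fpsS.
exists c; split; last first.
  rewrite !cS; case: n hn @c cS => // n' _ c _; split.
  - by rewrite /c subleading_fps0 /jacobi_sub /Acoef [a + _]addrC.
  - by apply: rational_value_coef => // x y hx hy D0; rewrite divr1 coef2E.
  - by apply: rational_value_coef => // x y hx hy D0; exact: coef3E.
  - by apply: rational_value_coef => // x y hx hy D0; exact: coef4E.
  - by apply: rational_value_coef => // x y hx hy D0; exact: coef5E.
have [r r0 hr] := jacobi_toda_summable ha hb.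
exists r => // l hl S; have [sa sb] : (forall j, fps_summable (- l) (alpha_fps a b j)) /\
    (forall j, fps_summable (- l) (beta_fps a b j)) by apply: hr; rewrite normrN.
have [sp _] := fps_eval_subleading sa n.
(* The sum starts at [m = 1]; after reindexing, one factor [- l] comes out. *)
have Scvg : S @ \oo --> - l * fps_eval (- l) (subleading_fps a b n).
  rewrite -(cvg_shiftn 1).
  have -> : (fun N => S (N + 1)%N) = (fun N =>
      - l * series (fun m => subleading_fps a b n m * (- l) ^+ m) N).
    apply/funext => N; rewrite /S addn1 big_add1 /= /series /= mulr_sumr.
    by apply: eq_bigr => m _; rewrite exprS mulrCA.
  by apply: cvgM; [exact: cvg_cst|exact: fps_eval_cvg].
split; first by apply/cvg_ex; eexists; exact: Scvg.
rewrite (cvg_lim _ Scvg) // /sigma (subleadingE ha hb sa sb hn); ring.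
Qed.
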